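(* Suppose $\mathcal R_1,\mathcal R_2\subset\mathcal G$ have Property 2. Then the eight seminorms $\|\cdot\|_{\mathcal R_1}$, $\|\cdot\|_{\mathcal R_2}$, $\|\cdot\|_{\mathcal R_1,0}$, $\|\cdot\|_{\mathcal R_2,0}$, $[\cdot]_{\mathcal R_1}$, $[\cdot]_{\mathcal R_2}$, $[\cdot]_{\mathcal R_1,0}$, $[\cdot]_{\mathcal R_2,0}$ on $U_{\mathrm{per}}$ are equivalent, and their kernel is $U_{\mathrm{iso},0,0}\cap U_{\mathrm{per}}$.
   Context: Euclidean group: $\mathrm E(n)$ consists of pairs $(A|b)$, $A\in\mathrm O(n)$, $b\in\mathbb R^n$, acting by $(A|b)\cdot x=Ax+b$, product $(A_1|b_1)(A_2|b_2)=(A_1A_2|b_1+A_1b_2)$; $\mathrm{rot}(A|b)=A$. Standing setting: $d=d_1+d_2$; $\mathcal S<\mathrm E(d_2)$ is a space group with translation subgroup $\mathcal T_{\mathcal S}$; $A\oplus(B|b)=(\mathrm{diag}(A,B)|(0,b))$; $\mathcal G$ is a discrete subgroup of $\mathrm E(d)$ contained in $\{A\oplus s:A\in\mathrm O(d_1),s\in\mathcal S\}$ projecting onto $\mathcal S$; $\mathcal T\subset\mathcal G$ maps bijectively onto $\mathcal T_{\mathcal S}$. There is $m_0\in\mathbb N$ such that $\mathcal T^N=\{t^N:t\in\mathcal T\}$ is a normal subgroup iff $N\in\mathcal M=m_0\mathbb N$, then isomorphic to $\mathbb Z^{d_2}$ of finite index; $\mathcal C_N$ is a fixed set of representatives of $\mathcal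 G/\mathcal T^N$. $U_{\mathrm{per}}$: maps $u:\mathcal G\to\mathbb R^d$ that are $\mathcal T^N$-periodic ($u(gt)=u(g)$, $t\in\mathcal T^N$) for some $N\in\mathcal M$. $x_0\in\mathbb R^d$ with $g\mapsto g\cdot x_0$ injective; $d_{\mathrm{aff}}=\dim\mathrm{aff}(\mathcal G\cdot x_0)$; assumed $\mathcal G\cdot x_0\subset\{0_{d-d_{\mathrm{aff}}}\}\times\mathbb R^{d_{\mathrm{aff}}}$ and $\mathcal G$ acts trivially on $\mathbb R^{d-d_{\mathrm{aff}}}\times\{0\}$. Let $\mathrm{Skew}_{0,d_2}(d)=\{\begin{pmatrix}S_1&S_2\\-S_2^T&0\end{pmatrix}:S_1\in\mathrm{Skew}(d_1),S_2\in\mathbb R^{d_1\times d_2}\}$. For $\mathcal R\subset\mathcal G$, maps $v:\mathcal R\to\mathbb R^d$: $U_{\mathrm{trans}}(\mathcal R)$: $\exists a$, $\mathrm{rot}(g)v(g)=a$ on $\mathcal R$; $U_{\mathrm{rot}}(\mathcal R)$ (resp. $U_{\mathrm{rot},0}(\mathcal R)$): $\exists S\in\mathrm{Skew}(d)$ (resp. $S\in\mathrm{Skew}_{0,d_2}(d)$) with $\mathrm{rot}(g)v(g)=S(g\cdot x_0-x_0)$ on $\mathcal R$; $U_{\mathrm{iso}}=U_{\mathrm{trans}}+U_{\mathrm{rot}}$, $U_{\mathrm{iso},0}=U_{\mathrm{trans}}+U_{\mathrm{rot},0}$. For finite $\mathcal R$ distances are Euclidean in $(\mathbb R^d)^{\mathcal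 R}$; $\nabla_{\mathcal R}u(g)(h)=u(gh)-\mathrm{rot}(h)^Tu(g)$. For $\mathcal T^N$-periodic $u$: $\|u\|_{\mathcal R}$ (resp. $\|u\|_{\mathcal R,0}$) $=\big(\frac1{|\mathcal C_N|}\sum_{g\in\mathcal C_N}\mathrm{dist}(u(g\,\cdot)|_{\mathcal R},U)^2\big)^{1/2}$ with $U=U_{\mathrm{iso}}(\mathcal R)$ (resp. $U_{\mathrm{iso},0}(\mathcal R)$), and $[u]_{\mathcal R}$ (resp. $[u]_{\mathcal R,0}$) $=\big(\frac1{|\mathcal C_N|}\sum_{g\in\mathcal C_N}\mathrm{dist}(\nabla_{\mathcal R}u(g),U)^2\big)^{1/2}$ with $U=U_{\mathrm{rot}}(\mathcal R)$ (resp. $U_{\mathrm{rot},0}(\mathcal R)$). $U_{\mathrm{iso},0,0}$: maps $u:\mathcal G\to\mathbb R^d$ with $a\in\mathbb R^d$, $S\in\mathrm{Skew}(d_1)$ such that $\mathrm{rot}(g)u(g)=a+(S\oplus0_{d_2\times d_2})(g\cdot x_0-x_0)$ for all $g\in\mathcal G$. Property 1: $\mathcal R$ finite, $\mathrm{id}\in\mathcal R$, $\mathrm{aff}(\mathcal R\cdot x_0)=\mathrm{aff}(\mathcal G\cdot x_0)$. Property 2: $\mathcal R$ finite, and there are $\mathcal R',\mathcal R''$ with $\mathrm{id}\in\mathcal R'$, $\mathcal R'$ generating $\mathcal G$, $\mathcal R''$ with Property 1, and $\{gh:g\in\mathcal R',h\in\mathcal R''\}\subset\mathcal R$. *)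

(* Defs.v *)
From HB Require Import structures.
From mathcomp Require Import all_boot all_order all_algebra.
From mathcomp Require Import boolp classical_sets reals.
Set Implicit Arguments.
Unset Strict Implicit.
Unset Printing Implicit Defensive.
Import Order.TTheory GRing.Theory Num.Theory.
Local Open Scope ring_scope.
Local Open Scope classical_set_scope.

Section Euclid.
Variables (R : realType) (n : nat).

Definition Eu := ('M[R]_n * 'cV[R]_n)%type.

Definition Erot (g : Eu) : 'M[R]_n := g.1.
Definition Eid : Eu := (1%:M, 0).
Definition Emul (g h : Eu) : Eu := (g.1 *m h.1, g.2 + g.1 *m h.2).
(* inverse of (A|b) for orthogonal A *)
Definition Einv (g : Eu) : Eu := (g.1^T, - (g.1^T *m g.2)).
Definition Eact (g : Eu) (x : 'cV[R]_n) : 'cV[R]_n := g.1 *m x + g.2.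
Definition Epow (g : Eu) (N : nat) : Eu := iter N (Emul g) Eid.

Definition orthogonal_mx (A : 'M[R]_n) : Prop := A *m A^T = 1%:M.

Definition sqnorm_mx {m k : nat} (A : 'M[R]_(m, k)) : R :=
  \sum_(i < m) \sum_(j < k) (A i j) ^+ 2.

Definition Edist2 (g h : Eu) : R := sqnorm_mx (g.1 - h.1) + sqnorm_mx (g.2 - h.2).

Definition is_subgroup (G : set Eu) : Prop :=
  [/\ (forall g, G g -> orthogonal_mx g.1), G Eid,
      (forall g h, G g -> G h -> G (Emul g h)) &
      (forall g, G g -> G (Einv g))].

Definition discrete_set (G : set Eu) : Prop :=
  forall g, G g -> exists2 eps : R, 0 < eps &
    forall h, G h -> Edist2 g h < eps -> h = g.

Definition normal_subgroup (H G : set Eu) : Prop :=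
  [/\ is_subgroup H, H `<=` G &
      forall g h, G g -> H h -> H (Emul (Emul g h) (Einv g))].

Definition translation_subgroup (S : set Eu) : set Eu :=
  [set s | S s /\ s.1 = 1%:M].

(* space group: discrete cocompact subgroup of E(n)
   (cocompact: S . K = R^n for a compact ball K) *)
Definition space_group (S : set Eu) : Prop :=
  [/\ is_subgroup S, discrete_set S &
      exists rho : R, forall x : 'cV[R]_n,
        exists2 s, S s & sqnorm_mx (x - Eact s 0) <= rho].

Definition generates (Rp : seq Eu) (G : set Eu) : Prop :=
  (forall h, h \in Rp -> G h) /\
  forall g, G g <-> exists w : seq (Eu * bool),
     (forall p, p \in w -> p.1 \in Rp) /\
     g = foldr (fun p acc => Emul (if p.2 then p.1 else Einv p.1) acc) Eid w.

Definition aff_hull (X : set 'cV[R]_n) : set 'cV[R]_n :=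
  [set y | exists (k : nat) (p : 'I_k -> 'cV[R]_n) (w : 'I_k -> R),
     [/\ forall i, X (p i), \sum_i w i = 1 & y = \sum_i w i *: p i]].

Definition aff_indep (k : nat) (p : 'I_k.+1 -> 'cV[R]_n) : Prop :=
  \rank (\matrix_(i < k) (p (lift ord0 i) - p ord0)^T) = k.

Definition aff_dim (A : set 'cV[R]_n) (k : nat) : Prop :=
  (exists p : 'I_k.+1 -> 'cV[R]_n, (forall i, A (p i)) /\ aff_indep p) /\
  (forall p : 'I_k.+2 -> 'cV[R]_n, (forall i, A (p i)) -> ~ aff_indep p).

Definition skew_mx (A : 'M[R]_n) : Prop := A^T = - A.

End Euclid.

Section Setting.
Variables (R : realType) (d1 d2 : nat).

Local Notation d := (d1 + d2)%N.
Local Notation E := (Eu R d).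
Local Notation V := (E -> 'cV[R]_d).

Definition dsum (A : 'M[R]_d1) (s : Eu R d2) : E :=
  (block_mx A 0 0 s.1, col_mx 0 s.2).

Definition proj (g : E) : Eu R d2 := (drsubmx g.1, dsubmx g.2).

Definition Tpow (T : set E) (N : nat) : set E := [set Epow t N | t in T].

Definition periodic (G T : set E) (N : nat) (u : V) : Prop :=
  forall g t, G g -> Tpow T N t -> u (Emul g t) = u g.

Definition standing_setting (S : set (Eu R d2)) (G T : set E) (m0 : nat)
    (C : nat -> seq E) (x0 : 'cV[R]_d) (daff : nat) : Prop :=
  [/\ space_group S,
      (is_subgroup G /\ discrete_set G),
      [/\
      (forall g, G g -> exists A s, [/\ orthogonal_mx A, S s & g = dsum A s]),
      (forall s, S s -> exists2 g, G g & proj g = s) &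
      [/\ T `<=` G,
          (forall t t', T t -> T t' -> proj t = proj t' -> t = t') &
          (proj @` T = translation_subgroup S) ] ],
      [/\ ((0 < m0)%N /\
        (forall N, (0 < N)%N -> (normal_subgroup (Tpow T N) G <-> (m0 %| N)%N))),
      (forall N, (0 < N)%N -> (m0 %| N)%N ->
         exists phi : 'rV[int]_d2 -> E,
           [/\ forall a b, phi (a + b) = Emul (phi a) (phi b),
               injective phi & range phi = Tpow T N]) &
      (forall N, (0 < N)%N -> (m0 %| N)%N ->
         [/\ uniq (C N), (forall c, c \in C N -> G c),
             (forall g, G g -> exists2 c, c \in C N & Tpow T N (Emul (Einv c) g)) &
             (forall c c', c \in C N -> c' \in C N ->
                 Tpow T N (Emul (Einv c) c') -> c = c')]) ] &
      [/\ (forall g h, G g -> G h -> Eact g x0 = Eact h x0 -> g = h),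
          aff_dim (aff_hull [set Eact g x0 | g in G]) daff,
          (daff <= d)%N,
          (forall g, G g -> forall i : 'I_d, (i < d - daff)%N -> Eact g x0 i 0 = 0) &
          (forall g, G g -> forall v : 'cV[R]_d,
              (forall i : 'I_d, (d - daff <= i)%N -> v i 0 = 0) -> g.1 *m v = v) ] ].

Definition skew0 (S : 'M[R]_d) : Prop :=
  exists (S1 : 'M[R]_d1) (S2 : 'M[R]_(d1, d2)),
    skew_mx S1 /\ S = block_mx S1 S2 (- S2^T) 0.

Section Spaces.
Variable x0 : 'cV[R]_d.
Variable r : seq E.

Definition U_trans : set V :=
  [set v | exists a, forall g, g \in r -> g.1 *m v g = a].
Definition U_rot : set V :=
  [set v | exists S, skew_mx S /\ forall g, g \in r -> g.1 *m v g = S *m (Eact g x0 - x0)].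
Definition U_rot0 : set V :=
  [set v | exists S, skew0 S /\ forall g, g \in r -> g.1 *m v g = S *m (Eact g x0 - x0)].
Definition Usum (U1 U2 : set V) : set V :=
  [set v | exists v1 v2, [/\ U1 v1, U2 v2 & forall h, h \in r -> v h = v1 h + v2 h]].
Definition U_iso : set V := Usum U_trans U_rot.
Definition U_iso0 : set V := Usum U_trans U_rot0.

Definition fnorm (v : V) : R := Num.sqrt (\sum_(h <- undup r) sqnorm_mx (v h)).
Definition distR (v : V) (U : set V) : R :=
  inf [set fnorm (fun h => v h - w h) | w in U].

End Spaces.

Definition grad (r : seq E) (u : V) (g : E) : V :=
  fun h => u (Emul g h) - (h.1)^T *m u g.

Definition avg_sem (C : nat -> seq E) (N : nat) (F : E -> R) : R :=
  Num.sqrt ((size (C N))%:R^-1 * \sum_(g <- C N) (F g) ^+ 2).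

Definition normR x0 C r N (u : V) : R :=
  avg_sem C N (fun g => distR r (fun h => u (Emul g h)) (U_iso x0 r)).
Definition normR0 x0 C r N (u : V) : R :=
  avg_sem C N (fun g => distR r (fun h => u (Emul g h)) (U_iso0 x0 r)).
Definition semR x0 C r N (u : V) : R :=
  avg_sem C N (fun g => distR r (grad r u g) (U_rot x0 r)).
Definition semR0 x0 C r N (u : V) : R :=
  avg_sem C N (fun g => distR r (grad r u g) (U_rot0 x0 r)).

Definition eight_seminorms x0 C (r1 r2 : seq E) (i : nat) : nat -> V -> R :=
  nth (fun _ _ => 0)
    [:: normR x0 C r1; normR x0 C r2; normR0 x0 C r1; normR0 x0 C r2;
        semR x0 C r1; semR x0 C r2; semR0 x0 C r1; semR0 x0 C r2] i.

Definition U_iso00 (G : set E) (x0 : 'cV[R]_d) : set V :=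
  [set u | exists (a : 'cV[R]_d) (S : 'M[R]_d1), skew_mx S /\
     forall g, G g -> g.1 *m u g = a + block_mx S 0 0 (0 : 'M[R]_d2) *m (Eact g x0 - x0)].

Definition Property1 (G : set E) (x0 : 'cV[R]_d) (r : seq E) : Prop :=
  [/\ forall h, h \in r -> G h, Eid R d \in r &
      aff_hull [set Eact g x0 | g in [set g | g \in r]] =
      aff_hull [set Eact g x0 | g in G]].

Definition Property2 (G : set E) (x0 : 'cV[R]_d) (r : seq E) : Prop :=
  (forall h, h \in r -> G h) /\
  exists r' r'' : seq E,
    [/\ Eid R d \in r', generates r' G, Property1 G x0 r'' &
        forall g h, g \in r' -> h \in r'' -> Emul g h \in r].

End Setting.

(* Main.v *)
(* Let (a_g, S_g) be the infinitesimal rigid motion closest to u(g .)|_R1. Comparing neighbouring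
   motions on affinely spanning sets, the equations
     u(gk) = rot(k)^T (u(g) + S_g (k x0 - x0)),    S_{gk} z = rot(k)^T S_g rot(k) z
   hold, for all k in G and all z in the directions of aff(G x0), up to errors bounded in l^2 by
   ||u||_{R1} uniformly in the period; words in the generators propagate them from R1 to G. It
   remains to bound the lower right d2 x d2 block of S_g. For commuting translations s, t in T^m0
   with translation parts b_s, b_t, the function p_s(g) = b_s . u(g) + (S_g b_s) . (x01, 0) satisfies
   D_t p_s = b_s . S_g b_t up to such errors, where D_t is the increment along t. The right-hand side
   is skew in (s, t), so D_s p_s and D_t p_s + D_s p_t are small, and summation by parts,
   <D_t p_s, D_s p_t> = <D_s p_s(. t), D_t p_t(. s)>, bounds D_t p_s. As G acts cocompactly on R^d2,
   the b_t span R^d2. *)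
Require Import Defs.
From HB Require Import structures.
From mathcomp Require Import all_boot all_order all_algebra.
From mathcomp Require Import boolp classical_sets reals.
From mathcomp Require Import ring lra.
Import Order.TTheory GRing.Theory Num.Theory.
Local Open Scope ring_scope.
Local Open Scope classical_set_scope.

Set Implicit Arguments.
Unset Strict Implicit.
Unset Printing Implicit Defensive.

(** * Inner products, norms and orthogonality of column vectors *)

Section LinearAlgebra.
Context {R : realType}.

Definition dot {n} (x y : 'cV[R]_n) : R := (x^T *m y) 0 0.

Lemma dotE n (x y : 'cV[R]_n) : dot x y = \sum_i x i 0 * y i 0.
Proof. by rewrite /dot mxE; apply: eq_bigr => i _; rewrite mxE. Qed.

Lemma dotC n (x y : 'cV[R]_n) : dot x y = dot y x.
Proof. by rewrite !dotE; apply: eq_bigr => i _; rewrite mulrC. Qed.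

Lemma dotDr n (x y z : 'cV[R]_n) : dot x (y + z) = dot x y + dot x z.
Proof. by rewrite /dot mulmxDr mxE. Qed.

Lemma dotNr n (x y : 'cV[R]_n) : dot x (- y) = - dot x y.
Proof. by rewrite /dot mulmxN mxE. Qed.

Lemma dotBr n (x y z : 'cV[R]_n) : dot x (y - z) = dot x y - dot x z.
Proof. by rewrite dotDr dotNr. Qed.

Lemma dotZr n c (x y : 'cV[R]_n) : dot x (c *: y) = c * dot x y.
Proof. by rewrite /dot -scalemxAr mxE. Qed.

Lemma dotDl n (x y z : 'cV[R]_n) : dot (x + y) z = dot x z + dot y z.
Proof. by rewrite dotC dotDr !(dotC z). Qed.

Lemma dotNl n (x y : 'cV[R]_n) : dot (- x) y = - dot x y.
Proof. by rewrite dotC dotNr (dotC y). Qed.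

Lemma dot_mulmxr n m (A : 'M[R]_(n, m)) x y : dot x (A *m y) = dot (A^T *m x) y.
Proof. by rewrite /dot trmx_mul trmxK mulmxA. Qed.

Lemma dot_skew n (A : 'M[R]_n) x y : skew_mx A -> dot x (A *m y) = - dot y (A *m x).
Proof. by move=> hA; rewrite dot_mulmxr hA mulNmx dotNl dotC. Qed.

Lemma dot_delta n (i : 'I_n) (x : 'cV[R]_n) : dot (delta_mx i 0) x = x i 0.
Proof.
rewrite dotE (bigD1 i) //= mxE !eqxx mul1r big1 ?addr0 // => j ji.
by rewrite mxE (negbTE ji) mul0r.
Qed.

Lemma dot_ext n (x y : 'cV[R]_n) : (forall z, dot z x = dot z y) -> x = y.
Proof. by move=> h; apply/colP => i; rewrite -!dot_delta h. Qed.

Lemma sqnorm_ge0 m n (A : 'M[R]_(m, n)) : 0 <= sqnorm_mx A.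
Proof. by apply: sumr_ge0 => i _; apply: sumr_ge0 => j _; apply: sqr_ge0. Qed.

Lemma sqnormE n (x : 'cV[R]_n) : sqnorm_mx x = \sum_i x i 0 ^+ 2.
Proof. by apply: eq_bigr => i _; rewrite big_ord1. Qed.

Lemma sqnorm_dot n (x : 'cV[R]_n) : sqnorm_mx x = dot x x.
Proof. by rewrite sqnormE dotE; apply: eq_bigr => i _; rewrite expr2. Qed.

Lemma sqnorm_eq0 n (x : 'cV[R]_n) : sqnorm_mx x = 0 -> x = 0.
Proof.
rewrite sqnormE => /eqP; rewrite psumr_eq0 => [/allP h|i _]; last exact: sqr_ge0.
apply/colP => i; have := h i (mem_index_enum i).
by rewrite /= sqrf_eq0 mxE => /eqP.
Qed.

Lemma sqnorm_orthogonal n (A : 'M[R]_n) (x : 'cV[R]_n) :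
  A^T *m A = 1%:M -> sqnorm_mx (A *m x) = sqnorm_mx x.
Proof. by move=> hA; rewrite !sqnorm_dot dot_mulmxr mulmxA hA mul1mx. Qed.

(** The squared norm of [|y|^2 x - (x.y) y] is [|y|^2 (|x|^2 |y|^2 - (x.y)^2)], and the factor
    [|y|^2 > 0] is divided out. *)
Lemma dot_CauchySchwarz n (x y : 'cV[R]_n) :
  dot x y ^+ 2 <= sqnorm_mx x * sqnorm_mx y.
Proof.
have [->|y0] := eqVneq y 0.
  by rewrite dotE big1 ?expr0n ?mulr_ge0 ?sqnorm_ge0 // => i _; rewrite mxE mulr0.
have yy : 0 < sqnorm_mx y.
  rewrite lt_neqAle sqnorm_ge0 andbT eq_sym.
  by apply: contra y0 => /eqP /sqnorm_eq0 ->.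
have := sqnorm_ge0 (sqnorm_mx y *: x - dot x y *: y).
rewrite sqnorm_dot dotBr !(dotZr, dotC _ x) !dotBr.
rewrite !(dotC (_ - _)) !(dotBr, dotZr) (dotC y x) -!sqnorm_dot => h.
rewrite -subr_ge0 -(pmulr_rge0 _ yy); apply: le_trans h _.
by rewrite le_eqVlt; apply/orP; left; apply/eqP; ring.
Qed.

(* Cokernel columns are orthogonal to the rows of M, so it suffices to show that they are orthogonal to z. *)
Lemma submx_orthogonal m n (M : 'M[R]_(m, n)) (z : 'cV[R]_n) :
  (forall y : 'cV_n, M *m y = 0 -> dot y z = 0) -> (z^T <= M)%MS.
Proof.
move=> h; rewrite submxE; apply/eqP/rowP => j.
have := h (cokermx M *m delta_mx j 0); rewrite mulmxA mulmx_coker mul0mx => /(_ erefl).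
by rewrite dotC /dot mulmxA -colE => h0; rewrite [RHS]mxE -[RHS]h0 [RHS]mxE.
Qed.

(** Greedy choice: a vector of [A] outside the current row space raises the rank, which cannot
    exceed [n]. *)
Lemma finite_spanning n (A : set 'cV[R]_n) :
  exists m (M : 'M[R]_(m, n)), (forall i, A (row i M)^T) /\
    forall x, A x -> (x^T <= M)%MS.
Proof.
suff H k : (k <= n)%N -> exists m (M : 'M[R]_(m, n)), (forall i, A (row i M)^T) /\
    ((forall x, A x -> (x^T <= M)%MS) \/ (k <= \rank M)%N).
  have [m [M [h1 [h2|h2]]]] := H n (leqnn n); exists m, M; split => // x _.
  by rewrite submx_full // /row_full eqn_leq rank_leq_col h2.
elim: k => [_|k IH kn].
  by exists 0%N, 0; split => [[]//|]; right.
have [m [M [h1 [h2|h2]]]] := IH (ltnW kn).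
  by exists m, M; split => //; left.
have [h3|/existsNP [x /not_implyP [Ax /negP nx]]] :=
  pselect (forall x, A x -> (x^T <= M)%MS).
  by exists m, M; split => //; left.
exists (m + 1)%N, (col_mx M x^T); split.
  move=> i; case: (splitP i) => j ij.
    have -> : i = lshift 1 j by apply: val_inj.
    by rewrite rowKu.
  have -> : i = rshift m j by apply: val_inj.
  by rewrite rowKd row_id trmxK.
right; apply: leq_ltn_trans h2 _; rewrite -addsmxE.
apply: rank_ltmx; rewrite ltmxE addsmxSl /=.
by apply: contra nx; apply: submx_trans (addsmxSr _ _).
Qed.
End LinearAlgebra.

(** * Existence of least-squares minimizers *)

Section LeastSquares.
Context {R : realType}.

Lemma sqnorm_mxvec m n (A : 'M[R]_(m, n)) : sqnorm_mx (mxvec A) = sqnorm_mx A.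
Proof.
rewrite /sqnorm_mx big_ord1 pair_bigA (reindex _ (curry_mxvec_bij _ _)) /=.
by apply: eq_bigr => -[i j] _; rewrite mxvecE.
Qed.

Lemma sqnorm_tr m n (A : 'M[R]_(m, n)) : sqnorm_mx A^T = sqnorm_mx A.
Proof.
rewrite /sqnorm_mx exchange_big; apply: eq_bigr => i _.
by apply: eq_bigr => j _; rewrite mxE.
Qed.

(* The normal equations [M^T M p = M^T x] are solvable: [M^T x] is orthogonal to [ker (M^T M) = ker M]. *)
Lemma least_squares_mx m k (M : 'M[R]_(m, k)) (x : 'cV_m) :
  exists p : 'cV_k, forall q, sqnorm_mx (x - M *m p) <= sqnorm_mx (x - M *m q).
Proof.
have /submxP [D hD] : ((M^T *m x)^T <= M^T *m M)%MS.
  apply: submx_orthogonal => y hy.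
  have My0 : M *m y = 0.
    apply: sqnorm_eq0; rewrite sqnorm_dot dot_mulmxr mulmxA hy dotC.
    by rewrite dotE big1 // => i _; rewrite mxE mulr0.
  by rewrite dot_mulmxr trmxK My0 dotE big1 // => i _; rewrite mxE mul0r.
have {}hD : M^T *m (x - M *m D^T) = 0.
  rewrite mulmxBr; apply/eqP; rewrite subr_eq0; apply/eqP.
  by apply: trmx_inj; rewrite hD mulmxA [RHS]trmx_mul trmxK trmx_mul trmxK.
exists D^T => q.
have -> : x - M *m q = (x - M *m D^T) + M *m (D^T - q).
  by rewrite mulmxBr addrA subrK.
move: (x - _) hD (D^T - q) => r hD w.
rewrite [leRHS]sqnorm_dot !dotDr !dotDl -!sqnorm_dot.
have -> : dot (M *m w) r = 0.
  by rewrite dotC dot_mulmxr hD dotE big1 // => i _; rewrite mxE mul0r.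
have -> : dot r (M *m w) = 0.
  by rewrite dot_mulmxr hD dotE big1 // => i _; rewrite mxE mul0r.
by rewrite addr0 add0r lerDl sqnorm_ge0.
Qed.

Lemma least_squares k m n (f : 'rV[R]_k -> 'M[R]_(m, n)) (x : 'M_(m, n)) :
  linear f ->
  exists p, forall q, sqnorm_mx (x - f p) <= sqnorm_mx (x - f q).
Proof.
move=> lf.
pose F : {linear 'rV[R]_k -> 'M[R]_(m, n)} :=
  HB.pack f (GRing.isLinear.Build R _ _ _ f lf).
have FE p : (lin1_mx (mxvec \o F))^T *m p = (mxvec (f p^T))^T.
  by have := mul_rV_lin1 (mxvec \o F) p^T; rewrite /= => <-; rewrite trmx_mul trmxK.
have [p hp] := least_squares_mx (lin1_mx (mxvec \o F))^T (mxvec x)^T.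
have sqE A B : sqnorm_mx ((mxvec A)^T - (mxvec B)^T) = sqnorm_mx (A - B :> 'M[R]_(m, n)).
  by rewrite -(sqnorm_mxvec (A - B)) -(sqnorm_tr (mxvec _)) !linearB.
by exists p^T => q; have := hp q^T; rewrite !FE trmxK !sqE.
Qed.
End LeastSquares.

(** * The Euclidean group and sums over cosets *)

Section EuclideanGroup.
Context {R : realType} {n : nat}.
Implicit Types g h k : Eu R n.

Lemma EmulA g h k : Emul g (Emul h k) = Emul (Emul g h) k.
Proof. by rewrite /Emul /= mulmxA mulmxDr addrA mulmxA. Qed.

Lemma Emul1 g : Emul (Eid R n) g = g.
Proof. by case: g => A b; rewrite /Emul /= !mul1mx add0r. Qed.

Lemma Emulg1 g : Emul g (Eid R n) = g.
Proof. by case: g => A b; rewrite /Emul /= mulmx1 mulmx0 addr0. Qed.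

Lemma orthogonal_mxT (A : 'M[R]_n) : orthogonal_mx A -> A^T *m A = 1%:M.
Proof. exact: mulmx1C. Qed.

Lemma EmulV g : orthogonal_mx g.1 -> Emul (Einv g) g = Eid R n.
Proof. by move=> /orthogonal_mxT hg; rewrite /Emul /= hg addNr. Qed.

Lemma EmulgV g : orthogonal_mx g.1 -> Emul g (Einv g) = Eid R n.
Proof.
by move=> hg; rewrite /Emul /= hg mulmxN mulmxA hg mul1mx subrr.
Qed.

Lemma Einv_mul g h : orthogonal_mx g.1 -> Einv (Emul g h) = Emul (Einv h) (Einv g).
Proof.
move=> /orthogonal_mxT hg; rewrite /Einv /Emul /= trmx_mul; congr pair.
by rewrite mulmxDr mulmxN !mulmxA -(mulmxA h.1^T g.1^T g.1) hg mulmx1 opprD addrC.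
Qed.

Lemma EinvK g : orthogonal_mx g.1 -> Einv (Einv g) = g.
Proof.
by case: g => A b /= hA; rewrite /Einv /= trmxK mulmxN opprK mulmxA hA mul1mx.
Qed.

Lemma orthogonal_Einv g : orthogonal_mx g.1 -> orthogonal_mx (Einv g).1.
Proof. by move=> hg; rewrite /orthogonal_mx /= trmxK; apply: orthogonal_mxT. Qed.

Lemma Eact_mul g h x : Eact (Emul g h) x = Eact g (Eact h x).
Proof. by rewrite /Eact /= mulmxDr mulmxA addrA addrAC. Qed.

Lemma Eact_sub g x y : Eact g x - Eact g y = g.1 *m (x - y).
Proof. by rewrite /Eact mulmxBr opprD addrACA subrr addr0. Qed.

(* Right translation permutes the left cosets of the normal subgroup H. *)
Lemma sum_coset_shift (G H : set (Eu R n)) (c : seq (Eu R n)) (f : Eu R n -> R) k :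
  is_subgroup G -> normal_subgroup H G ->
  uniq c -> (forall g, g \in c -> G g) ->
  (forall g, G g -> exists2 c0, c0 \in c & H (Emul (Einv c0) g)) ->
  (forall g h, g \in c -> h \in c -> H (Emul (Einv g) h) -> g = h) ->
  (forall g t, G g -> H t -> f (Emul g t) = f g) -> G k ->
  \sum_(g <- c) f (Emul g k) = \sum_(g <- c) f g.
Proof.
move=> [Go G1 GM GV] [[_ H1 HM HV] HG HN] cu cG cov sep fper Gk.
have /choice [p hp] : forall g, exists c0, G g -> c0 \in c /\ H (Emul (Einv c0) g).
  move=> g; have [Gg|nGg] := pselect (G g); last by exists g.
  by have [c0 ? ?] := cov _ Gg; exists c0.
have pE g : G g -> g = Emul (p g) (Emul (Einv (p g)) g).
  move=> Gg; have [pc _] := hp _ Gg.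
  by rewrite EmulA EmulgV ?Emul1 //; apply/Go/cG.
rewrite (eq_big_seq (fun g => f (p (Emul g k)))) => [|g gc]; last first.
  have Ggk := GM _ _ (cG _ gc) Gk; have [pc Hp] := hp _ Ggk.
  by rewrite {1}(pE _ Ggk) fper //; apply: cG.
rewrite -(big_map (fun g => p (Emul g k)) xpredT f); apply: perm_big.
(* If [gk] and [hk] have the same representative [q], conjugating [(q^-1 g k)^-1 (q^-1 h k)] by [k]
   shows that [g^-1 h] lies in the normal subgroup [H]. *)
have iu : uniq [seq p (Emul g k) | g <- c].
  rewrite map_inj_in_uniq // => g h gc hc eqp.
  have [Gg Gh] := (cG _ gc, cG _ hc).
  have [Ggk Ghk] := (GM _ _ Gg Gk, GM _ _ Gh Gk).
  have [_ Hg] := hp _ Ggk; have [pc Hh] := hp _ Ghk; rewrite eqp in Hg.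
  apply: sep => //.
  have HH := HN k _ Gk (HM _ _ (HV _ Hg) Hh).
  set w := Emul (Emul k _) _ in HH; suff <- : w = Emul (Einv g) h by [].
  rewrite {HH}/w.
  have [[og oh] ok] := (Go _ Gg, Go _ Gh, Go _ Gk).
  have oq := Go _ (cG _ pc); move: (p _) oq => q oq.
  rewrite Einv_mul; last exact: orthogonal_Einv.
  rewrite EinvK // .
  rewrite (Einv_mul _ og) !EmulA (EmulgV ok) Emul1.
  by rewrite -(EmulA _ q) (EmulgV oq) Emulg1 -(EmulA _ k) (EmulgV ok) Emulg1.
apply: uniq_perm => //.
have sub : {subset [seq p (Emul g k) | g <- c] <= c}.
  by move=> x /mapP [g gc ->]; have [] := hp _ (GM _ _ (cG _ gc) Gk).
by have [] := uniq_min_size iu sub _; rewrite ?size_map.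
Qed.
End EuclideanGroup.

(** * Distances to spaces of infinitesimal rigid motions *)

Section Distances.
Context {R : realType} {d1 d2 : nat}.
Local Notation d := (d1 + d2)%N.
Local Notation E := (Eu R d).
Local Notation V := (E -> 'cV[R]_d).
Variables (x0 : 'cV[R]_d) (r : seq E).

Lemma fnorm_ge0 (v : V) : 0 <= fnorm r v.
Proof. exact: sqrtr_ge0. Qed.

Lemma sqr_fnorm (v : V) : fnorm r v ^+ 2 = \sum_(h <- undup r) sqnorm_mx (v h).
Proof. by rewrite sqr_sqrtr // sumr_ge0 // => h _; apply: sqnorm_ge0. Qed.

Lemma eq_fnorm (v w : V) : {in r, v =1 w} -> fnorm r v = fnorm r w.
Proof.
move=> h; congr Num.sqrt; apply: eq_big_seq => x; rewrite mem_undup => /h ->.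
by [].
Qed.

Lemma distR_le (v w : V) (U : set V) : U w -> distR r v U <= fnorm r (fun h => v h - w h).
Proof.
move=> Uw; apply: ge_inf; last by exists w.
by exists 0 => _ [w' _ <-]; apply: fnorm_ge0.
Qed.

Lemma le_distR (v : V) (U : set V) y : U !=set0 ->
  (forall w, U w -> y <= fnorm r (fun h => v h - w h)) -> y <= distR r v U.
Proof.
move=> [w0 Uw0] h; apply: lb_le_inf; first by exists (fnorm r (fun h => v h - w0 h)), w0.
by move=> _ [w Uw <-]; apply: h.
Qed.

Lemma distR_ge0 (v : V) (U : set V) : U !=set0 -> 0 <= distR r v U.
Proof. by move=> U0; apply: le_distR => // w _; apply: fnorm_ge0. Qed.

Lemma sqr_distR_le (v w : V) (U : set V) : U w ->
  distR r v U ^+ 2 <= \sum_(h <- undup r) sqnorm_mx (v h - w h).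
Proof.
move=> Uw; rewrite -(sqr_fnorm (fun h => v h - w h)).
rewrite ler_sqr ?nnegrE ?fnorm_ge0 ?distR_le //.
by apply: distR_ge0; exists w.
Qed.

(** Covers both enlarging the space and absorbing a part of [v] into the competitor, since only the
    residuals on [r] matter. *)
Lemma distR_mono (v v' : V) (U U' : set V) : U !=set0 ->
  (forall w, U w -> exists2 w', U' w' & {in r, forall h, v' h - w' h = v h - w h}) ->
  distR r v' U' <= distR r v U.
Proof.
move=> U0 h; apply: le_distR => // w /h [w' Uw' e].
by apply: le_trans (distR_le _ Uw') _; rewrite (eq_fnorm e).
Qed.

Lemma skew_mxB n (X : 'M[R]_n) : skew_mx (X - X^T).
Proof. by rewrite /skew_mx linearB /= trmxK opprB. Qed.

Hypothesis ro : forall h, h \in r -> orthogonal_mx h.1.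

Lemma U_isoP (w : V) : U_iso x0 r w <-> exists a S, skew_mx S /\
  forall h, h \in r -> w h = h.1^T *m (a + S *m (Eact h x0 - x0)).
Proof.
split=> [[v1 [v2 [[a ha] [S [Sk hS]] e]]]|[a [S [Sk e]]]].
  exists a, S; split => // h hr; rewrite -(hS _ hr) -(ha _ hr) -mulmxDr mulmxA.
  by rewrite orthogonal_mxT ?mul1mx ?e //; apply: ro.
exists (fun h => h.1^T *m a), (fun h => h.1^T *m (S *m (Eact h x0 - x0))); split.
- by exists a => g gr; rewrite mulmxA ro // mul1mx.
- by exists S; split => // g gr; rewrite mulmxA ro // mul1mx.
- by move=> h hr; rewrite e // mulmxDr.
Qed.

(** The infimum is attained because the competitors, restricted to [r], are the image of a
    finite-dimensional space of pairs [(a, S)] under a linear map. *)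
Lemma U_iso_minimizer (v : V) : exists a S, skew_mx S /\
  distR r v (U_iso x0 r) ^+ 2 = \sum_(h <- undup r)
    sqnorm_mx (v h - h.1^T *m (a + S *m (Eact h x0 - x0))).
Proof.
pose hh (i : 'I_(size (undup r))) := nth (Eid R d) (undup r) i.
pose L (p : 'rV[R]_(d + d * d)) := (lsubmx p)^T.
pose X (p : 'rV[R]_(d + d * d)) : 'M_d := vec_mx (rsubmx p).
(* Writing skew matrices as [X - X^T] makes the parameter space a full vector space; [X = S/2]
   recovers a given skew [S]. *)
pose Sk p := X p - (X p)^T.
pose f p : 'M_(size (undup r), d) :=
  \matrix_(i, j) ((hh i).1^T *m (L p + Sk p *m (Eact (hh i) x0 - x0))) j 0.
have LE c p q : L (c *: p + q) = c *: L p + L q by rewrite /L !linearP.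
have SE c p q : Sk (c *: p + q) = c *: Sk p + Sk q.
  have XE : X (c *: p + q) = c *: X p + X q by rewrite /X !linearP.
  by rewrite /Sk XE [(_ + _)^T]linearP /= opprD scalerBr addrACA.
have fE p i j : f p i j =
    ((hh i).1^T *m (L p + Sk p *m (Eact (hh i) x0 - x0))) j 0 by rewrite mxE.
have lf : linear f.
  move=> c p q; apply/matrixP => i j.
  rewrite fE [RHS]mxE [X in _ = X + _]mxE !fE LE SE mulmxDl -scalemxAl addrACA.
  by rewrite -scalerDr mulmxDr -scalemxAr [LHS]mxE [X in X + _ = _]mxE.
pose x : 'M_(size (undup r), d) := \matrix_(i, j) v (hh i) j 0.
have sqE a S p : L p = a -> Sk p = S -> sqnorm_mx (x - f p) =
    \sum_(h <- undup r) sqnorm_mx (v h - h.1^T *m (a + S *m (Eact h x0 - x0))).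
  move=> <- <-; rewrite (big_nth (Eid R d)) big_mkord; apply: eq_bigr => i _.
  rewrite sqnormE; apply: eq_bigr => j _.
  rewrite -/(hh i) [X in X ^+ 2]mxE [x i j]mxE [(- f p) i j]mxE fE.
  by rewrite [in RHS]mxE [(- _ : 'cV_d) j 0 in RHS]mxE.
have [p hp] := least_squares x lf.
exists (L p), (Sk p); split; first exact: skew_mxB.
pose w h := h.1^T *m (L p + Sk p *m (Eact h x0 - x0)).
have -> : distR r v (U_iso x0 r) = fnorm r (fun h => v h - w h).
  apply/eqP; rewrite eq_le; apply/andP; split.
    by apply/distR_le/U_isoP; exists (L p), (Sk p); split => //; apply: skew_mxB.
  apply: le_distR => [|w' /U_isoP [a [S [hS e]]]].
    by exists w; apply/U_isoP; exists (L p), (Sk p); split => //; apply: skew_mxB.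
  pose q : 'rV[R]_(d + d * d) := row_mx a^T (mxvec (2^-1 *: S)).
  have Lq : L q = a by rewrite /L row_mxKl trmxK.
  have Sq : Sk q = S.
    rewrite /Sk /X row_mxKr mxvecK linearZ /= hS scalerN opprK -scalerDl.
    by rewrite [_ + _](_ : _ = 1) ?scale1r //; field.
  rewrite ler_sqrt ?sumr_ge0 // => [|h _]; last exact: sqnorm_ge0.
  rewrite [leRHS](_ : _ = sqnorm_mx (x - f q)); last first.
    rewrite (sqE _ _ _ Lq Sq); apply: eq_big_seq => h; rewrite mem_undup => hr.
    by rewrite e.
  by rewrite -(sqE _ _ p erefl erefl) hp.
by rewrite sqr_fnorm.
Qed.

End Distances.

(** * Quantities dominated in l^2 by the deviation from rigid motions *)

Section Domination.
Context {R : realType} {d1 d2 : nat}.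
Local Notation d := (d1 + d2)%N.
Local Notation E := (Eu R d).
Local Notation V := (E -> 'cV[R]_d).
Variables (G T : set E) (m0 : nat) (C : nat -> seq E) (x0 : 'cV[R]_d) (r1 : seq E).

Hypothesis GG : is_subgroup G.
Hypothesis Tnormal : forall N, (0 < N)%N -> (m0 %| N)%N -> normal_subgroup (Tpow T N) G.
Hypothesis Creps : forall N, (0 < N)%N -> (m0 %| N)%N ->
  [/\ uniq (C N), (forall c, c \in C N -> G c),
      (forall g, G g -> exists2 c, c \in C N & Tpow T N (Emul (Einv c) g)) &
      (forall c c', c \in C N -> c' \in C N -> Tpow T N (Emul (Einv c) c') -> c = c')].
Hypothesis r1G : forall h, h \in r1 -> G h.

Lemma G_orthogonal g : G g -> orthogonal_mx g.1. Proof. by case: GG => h _ _ _; apply: h. Qed.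
Lemma G1 : G (Eid R d). Proof. by case: GG. Qed.
Lemma GM g h : G g -> G h -> G (Emul g h). Proof. by case: GG => _ _ h' _; apply: h'. Qed.
Lemma GV g : G g -> G (Einv g). Proof. by case: GG => _ _ _ h'; apply: h'. Qed.

Definition Tper (W : Type) N (f : E -> W) :=
  forall g t, G g -> Tpow T N t -> f (Emul g t) = f g.

(* A displacement together with candidates [a g + S g (h x0 - x0)] for the infinitesimal
   rigid motion closest to [h |-> rot(h) u(gh)]. *)
Record state := State
  { period : nat; disp : V; shift : V; skewp : E -> 'M[R]_d }.

Definition valid st :=
  [/\ (0 < period st)%N, (m0 %| period st)%N,
      Tper (period st) (disp st), Tper (period st) (shift st) &
      Tper (period st) (skewp st) /\ forall g, skew_mx (skewp st g)].

Definition err st g : R := \sum_(h <- undup r1)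
  sqnorm_mx (disp st (Emul g h) -
             h.1^T *m (shift st g + skewp st g *m (Eact h x0 - x0))).

(* The constant may depend on [q] but not on the state, hence not on the period. *)
Definition dom (q : state -> E -> R) :=
  (forall st, valid st -> Tper (period st) (q st)) /\
  exists2 c : R, 0 <= c & forall st, valid st ->
    \sum_(g <- C (period st)) q st g ^+ 2 <= c * \sum_(g <- C (period st)) err st g.

Lemma err_ge0 st g : 0 <= err st g.
Proof. by apply: sumr_ge0 => h _; apply: sqnorm_ge0. Qed.

Lemma sum_err_ge0 st : 0 <= \sum_(g <- C (period st)) err st g.
Proof. by apply: sumr_ge0 => h _; apply: err_ge0. Qed.

(** One has [g t k = (g k) (k^-1 t k)], and normality puts [k^-1 t k] into [T^N]. *)
Lemma Tper_shift (W : Type) N (f : E -> W) k : (0 < N)%N -> (m0 %| N)%N ->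
  Tper N f -> G k -> Tper N (fun g => f (Emul g k)).
Proof.
move=> N0 mN fp Gk g t Gg Tt; have [[_ _ _ _] _ TN] := Tnormal N0 mN.
have := TN (Einv k) t (GV Gk) Tt; rewrite EinvK; last exact: G_orthogonal.
set t' := Emul _ k => Tt'; rewrite -[in RHS](fp _ t') //; last exact: GM.
congr f; rewrite /t' !EmulA -(EmulA g k) EmulgV ?Emulg1 //; exact: G_orthogonal.
Qed.

Lemma sum_shift N (f : E -> R) k : (0 < N)%N -> (m0 %| N)%N -> Tper N f -> G k ->
  \sum_(g <- C N) f (Emul g k) = \sum_(g <- C N) f g.
Proof.
move=> N0 mN fp Gk; have [? ? ? ?] := Creps N0 mN.
exact: (sum_coset_shift GG (Tnormal N0 mN)).
Qed.

Lemma CG N c : (0 < N)%N -> (m0 %| N)%N -> c \in C N -> G c.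
Proof. by move=> N0 mN; have [_ h _ _] := Creps N0 mN; apply: h. Qed.

Lemma dom_eq q q' : dom q ->
  (forall st, valid st -> forall g, G g -> q' st g = q st g) -> dom q'.
Proof.
move=> [qp [c c0 hc]] e; split=> [st vst g t Gg Tt|].
  have [N0 mN _ _ _] := vst; have [_ TG _] := Tnormal N0 mN.
  by rewrite !e ?(qp _ vst) //; apply: GM => //; apply: TG.
exists c => // st vst; apply: le_trans (hc _ vst).
have [N0 mN _ _ _] := vst; rewrite le_eqVlt; apply/orP; left; apply/eqP.
by apply: eq_big_seq => g /(CG N0 mN) Gg; rewrite e.
Qed.

Lemma dom0 : dom (fun _ _ => 0).
Proof.
split=> //; exists 0 => // st _; rewrite big1 ?mul0r // => g _.
by rewrite expr0n.
Qed.

Lemma domD q q' : dom q -> dom q' -> dom (fun st g => q st g + q' st g).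
Proof.
move=> [qp [c c0 hc]] [qp' [c' c'0 hc']]; split=> [st vst g t Gg Tt|].
  by rewrite (qp _ vst) // (qp' _ vst).
exists (2 * c + 2 * c') => [|st vst]; first by rewrite addr_ge0 ?mulr_ge0.
have := hc _ vst; have := hc' _ vst => h' h.
apply: (@le_trans _ _ (\sum_(g <- C (period st)) (2 * q st g ^+ 2 + 2 * q' st g ^+ 2))).
  apply: ler_sum => g _; rewrite -subr_ge0.
  have := sqr_ge0 (q st g - q' st g); rewrite !expr2; lra.
rewrite big_split /= -!mulr_sumr [leRHS]mulrDl -!mulrA.
by rewrite lerD // ler_pM2l.
Qed.

Lemma domZ a q : dom q -> dom (fun st g => a * q st g).
Proof.
move=> [qp [c c0 hc]]; split=> [st vst g t Gg Tt|]; first by rewrite (qp _ vst).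
exists (a ^+ 2 * c) => [|st vst]; first by rewrite mulr_ge0 ?sqr_ge0.
under eq_bigr do rewrite exprMn.
by rewrite -mulr_sumr -mulrA ler_wpM2l ?sqr_ge0 ?hc.
Qed.

Lemma domB q q' : dom q -> dom q' -> dom (fun st g => q st g - q' st g).
Proof.
move=> dq dq'; apply: dom_eq (domD dq (domZ (-1) dq')) _ => st _ g _.
by rewrite mulN1r.
Qed.

Lemma dom_sum (I : Type) (s : seq I) (q : I -> state -> E -> R) :
  (forall i, dom (q i)) -> dom (fun st g => \sum_(i <- s) q i st g).
Proof.
move=> dq; elim: s => [|i s IH].
  by apply: dom_eq dom0 _ => st _ g _; rewrite big_nil.
by apply: dom_eq (domD (dq i) IH) _ => st _ g _; rewrite big_cons.
Qed.

(** Right translation only permutes the cosets, so the constant is unchanged. *)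
Lemma dom_shift q k : G k -> dom q -> dom (fun st g => q st (Emul g k)).
Proof.
move=> Gk [qp [c c0 hc]]; split=> [st vst|].
  by have [N0 mN _ _ _] := vst; apply: Tper_shift => //; apply: qp.
exists c => // st vst; have [N0 mN _ _ _] := vst.
rewrite (@sum_shift _ (fun g => q st g ^+ 2)) ?hc // => g t Gg Tt.
by rewrite (qp _ vst).
Qed.

(** Testing against fixed vectors reduces vector estimates to the scalar calculus; [vdom_sqnorm]
    returns to norms. *)
Definition vdom n (q : state -> E -> 'cV[R]_n) := forall y, dom (fun st g => dot y (q st g)).

Lemma vdom_eq n (q q' : state -> E -> 'cV[R]_n) : vdom q ->
  (forall st, valid st -> forall g, G g -> q' st g = q st g) -> vdom q'.
Proof. by move=> dq e y; apply: dom_eq (dq y) _ => st vst g Gg; rewrite e. Qed.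

Lemma vdom0 n : vdom (fun _ _ => 0 : 'cV[R]_n).
Proof.
move=> y; apply: dom_eq dom0 _ => st _ g _.
by rewrite dotE big1 // => i _; rewrite mxE mulr0.
Qed.

Lemma vdomD n (q q' : state -> E -> 'cV[R]_n) :
  vdom q -> vdom q' -> vdom (fun st g => q st g + q' st g).
Proof. by move=> dq dq' y; apply: dom_eq (domD (dq y) (dq' y)) _ => *; rewrite dotDr. Qed.

Lemma vdomB n (q q' : state -> E -> 'cV[R]_n) :
  vdom q -> vdom q' -> vdom (fun st g => q st g - q' st g).
Proof. by move=> dq dq' y; apply: dom_eq (domB (dq y) (dq' y)) _ => *; rewrite dotBr. Qed.

Lemma vdomM m n (A : 'M[R]_(m, n)) (q : state -> E -> 'cV[R]_n) :
  vdom q -> vdom (fun st g => A *m q st g).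
Proof. by move=> dq y; apply: dom_eq (dq (A^T *m y)) _ => *; rewrite dot_mulmxr. Qed.

Lemma vdomZ n a (q : state -> E -> 'cV[R]_n) : vdom q -> vdom (fun st g => a *: q st g).
Proof. by move=> dq y; apply: dom_eq (domZ a (dq y)) _ => *; rewrite dotZr. Qed.

Lemma vdom_shift n (q : state -> E -> 'cV[R]_n) k :
  G k -> vdom q -> vdom (fun st g => q st (Emul g k)).
Proof. by move=> Gk dq y; apply: (dom_shift Gk (dq y)). Qed.

Lemma vdom_sqnorm n (q : state -> E -> 'cV[R]_n) : vdom q ->
  exists2 c : R, 0 <= c & forall st, valid st ->
    \sum_(g <- C (period st)) sqnorm_mx (q st g) <= c * \sum_(g <- C (period st)) err st g.
Proof.
move=> dq; have /choice [c hc] : forall i : 'I_n, exists c : R, 0 <= c /\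
    forall st, valid st -> \sum_(g <- C (period st)) (q st g i 0) ^+ 2 <=
      c * \sum_(g <- C (period st)) err st g.
  move=> i; have [_ [c c0 hc]] := dq (delta_mx i 0); exists c; split=> // st vst.
  apply: le_trans (hc _ vst); rewrite le_eqVlt; apply/orP; left; apply/eqP.
  by apply: eq_bigr => g _; rewrite dot_delta.
exists (\sum_i c i) => [|st vst]; first by apply: sumr_ge0 => i _; have [] := hc i.
rewrite mulr_suml; under eq_bigr do rewrite sqnormE.
rewrite exchange_big; apply: ler_sum => i _.
by have [_ h] := hc i; apply: h.
Qed.

(** The squared norm of the residual is one summand of [err], so Cauchy-Schwarz gives the constant
    [|y|^2]. *)
Lemma vdom_err h : h \in r1 -> vdom (fun st g => disp st (Emul g h) -
  h.1^T *m (shift st g + skewp st g *m (Eact h x0 - x0))).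
Proof.
move=> hr y; split=> [st vst g t Gg Tt|].
  have [N0 mN up ap [Sp _]] := vst.
  by rewrite (Tper_shift N0 mN up (r1G hr)) // ap // Sp.
exists (sqnorm_mx y) => [|st vst]; first exact: sqnorm_ge0.
rewrite mulr_sumr; apply: ler_sum => g _.
apply: le_trans (dot_CauchySchwarz _ _) _; apply: ler_wpM2l; first exact: sqnorm_ge0.
rewrite /err (bigD1_seq h) ?undup_uniq ?mem_undup //= lerDl.
by apply: sumr_ge0 => h' _; apply: sqnorm_ge0.
Qed.

(** A vanishing sum of squares forces zero at the representatives, and periodicity carries this to
    all of [G]. *)
Lemma vdom_eq0 n (q : state -> E -> 'cV[R]_n) st : vdom q -> valid st ->
  \sum_(g <- C (period st)) err st g = 0 -> forall g, G g -> q st g = 0.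
Proof.
move=> dq vst e0 g Gg; apply: dot_ext => y.
have [qp [c _ /(_ _ vst)]] := dq y; rewrite e0 mulr0 => hc.
have [N0 mN _ _ _] := vst; have [_ _ cov _] := Creps N0 mN.
have [c0 c0C Tc] := cov _ Gg.
have {hc} : \sum_(g <- C (period st)) dot y (q st g) ^+ 2 == 0.
  by rewrite eq_le hc sumr_ge0 // => i _; apply: sqr_ge0.
rewrite psumr_eq0 => [/allP /(_ _ c0C)|i _]; last exact: sqr_ge0.
rewrite /= sqrf_eq0 => /eqP; have Gc := CG N0 mN c0C.
rewrite -(qp _ vst _ _ Gc Tc) EmulA EmulgV ?Emul1; last exact: G_orthogonal.
by move=> ->; rewrite dotE big1 // => i _; rewrite mxE mulr0.
Qed.

(** * Translational directions and the span of the orbit *)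

Variables (rgen raff : seq E).
Hypothesis Gblock : forall g, G g -> exists A (s : Eu R d2), orthogonal_mx A /\ g = dsum A s.
Hypothesis cocompact : exists rho, forall x : 'cV[R]_d2,
  exists2 g, G g & sqnorm_mx (x - dsubmx g.2) <= rho.
Hypothesis m0_gt0 : (0 < m0)%N.
Hypothesis Tcomm : forall s t, Tpow T m0 s -> Tpow T m0 t -> Emul s t = Emul t s.
Hypothesis Ttrans : forall t, Tpow T m0 t -> drsubmx t.1 = 1%:M.
Hypothesis gen_id : Eid R d \in rgen.
Hypothesis genG : generates rgen G.
Hypothesis affG : Property1 G x0 raff.
Hypothesis r1_prod : forall g h, g \in rgen -> h \in raff -> Emul g h \in r1.

Lemma TG t : Tpow T m0 t -> G t.
Proof. by have [_ h _] := Tnormal m0_gt0 (dvdnn m0); apply: h. Qed.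

(* Orthogonal projection onto the translational directions [{0} x R^d2]. *)
Definition ptr : 'M[R]_d := block_mx 0 0 0 1%:M.

Lemma ptr_sym : ptr^T = ptr.
Proof. by rewrite /ptr tr_block_mx !trmx0 trmx1. Qed.

Lemma ptrK : ptr *m ptr = ptr.
Proof. by rewrite /ptr mulmx_block !(mul0mx, mulmx0, mulmx1, addr0, add0r). Qed.

Lemma dot_ptr x y : dot x (ptr *m y) = dot (ptr *m x) y.
Proof. by rewrite dot_mulmxr ptr_sym. Qed.

Lemma ptr_col (y : 'cV[R]_d) : ptr *m y = col_mx 0 (dsubmx y).
Proof. by rewrite -{1}(vsubmxK y) /ptr mul_block_col !mul0mx mul1mx !add0r. Qed.

Lemma ptr_trans g : G g -> ptr *m g.2 = g.2.
Proof. by move=> /Gblock [A [s [_ ->]]]; rewrite ptr_col /= col_mxKd. Qed.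

Lemma ptr_T t : Tpow T m0 t -> t.1 *m ptr = ptr /\ ptr *m t.1 = ptr.
Proof.
move=> Tt; have := Ttrans Tt; have [A [s [_ ->]]] := Gblock (TG Tt).
rewrite /= block_mxKdr => ->.
by rewrite /ptr !mulmx_block !(mul0mx, mulmx0, mulmx1, mul1mx, addr0, add0r).
Qed.

Lemma orbit_sub (g : E) x : Eact g x - x = (g.1 *m x - x) + g.2.
Proof. by rewrite /Eact addrAC. Qed.

(** By cocompactness every [x] in [R^d2] is at bounded distance from the translation part of some
    [g], so the linear form given by the lower part [y2] of [y] is bounded on [R^d2], hence zero. *)
Lemma bounded_orbit_ptr0 (y : 'cV[R]_d) (K : R) :
  (forall g, G g -> dot y (Eact g x0 - x0) ^+ 2 <= K) -> ptr *m y = 0.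
Proof.
move=> hK; have [rho hrho] := cocompact.
set y2 := dsubmx y; set q := sqnorm_mx y2; set B := sqnorm_mx y * sqnorm_mx x0.
(* Bounds the square of a signed sum of four terms whose squares are at most [q * rho], [K], [B] and
   [B]. *)
pose K' := 4 * (q * rho + K + B + B).
have key x : dot y2 x ^+ 2 <= K'.
  have [g Gg hg] := hrho x; set s := dsubmx g.2 in hg.
  have e : dot y2 x = dot y2 (x - s) + dot y (Eact g x0 - x0) - dot y (g.1 *m x0) + dot y x0.
    have -> : dot y2 x = dot y2 (x - s) + dot y2 s by rewrite dotBr subrK.
    have -> : dot y2 s = dot y g.2.
      rewrite -[in RHS](ptr_trans Gg) dot_ptr !ptr_col [RHS]dotE big_split_ord /= [LHS]dotE.
      rewrite -(vsubmxK g.2) -/s [X in _ = X + _]big1 ?add0r => [|i _]; last first.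
        by rewrite col_mxEu mxE mul0r.
      by apply: eq_bigr => i _; rewrite !col_mxEd.
    by rewrite orbit_sub !(dotDr, dotNr); ring.
  have h1 := dot_CauchySchwarz y2 (x - s).
  have h2 := hK _ Gg.
  have h3 := dot_CauchySchwarz y (g.1 *m x0).
  have h4 := dot_CauchySchwarz y x0.
  rewrite (sqnorm_orthogonal _ (orthogonal_mxT (G_orthogonal Gg))) in h3.
  have h1' : dot y2 (x - s) ^+ 2 <= q * rho.
    by apply: le_trans h1 _; apply: ler_wpM2l => //; apply: sqnorm_ge0.
  rewrite -/B in h3 h4; rewrite {}e /K'.
  move: (dot y2 _) (dot y (Eact _ _ - _)) (dot y (g.1 *m _)) (dot y x0) h1' h2 h3 h4.
  move=> a b c e ha hb hc he.
  have := sqr_ge0 (a - b); have := sqr_ge0 (a + c); have := sqr_ge0 (a - e).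
  have := sqr_ge0 (b + c); have := sqr_ge0 (b - e); have := sqr_ge0 (c + e).
  by rewrite !expr2 in ha hb hc he *; nra.
have q0 : q = 0.
  apply/eqP; rewrite eq_le sqnorm_ge0 andbT leNgt; apply/negP => qp.
  (* At this multiple of [y2] the form takes the value [K' + 1], whose square exceeds [K']. *)
  have := key (((K' + 1) / q) *: y2).
  rewrite dotZr -sqnorm_dot -/q divfK ?gt_eqF // => h.
  have := sqr_ge0 (K'); have := key 0; have := sqr_ge0 (dot y2 0).
  by rewrite !expr2 in h *; nra.
by rewrite ptr_col -/y2 (sqnorm_eq0 q0) col_mx0.
Qed.

(** By Property 1 this is the direction space of the affine hull of the whole orbit [G x0], although
    only the finite list [raff] enters. *)
Definition span_orbit (z : 'cV[R]_d) : Prop :=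
  (z^T <= \matrix_(i < size raff) (Eact (nth (Eid R d) raff i) x0 - x0)^T)%MS.

Lemma span_orbitP z : span_orbit z <-> exists w : 'I_(size raff) -> R,
  z = \sum_i w i *: (Eact (nth (Eid R d) raff i) x0 - x0).
Proof.
rewrite /span_orbit; set M := (\matrix_i _)%R; split=> [/submxP[D hD]|[w ->]].
  exists (fun i => D 0 i); apply: trmx_inj; rewrite hD mulmx_sum_row linear_sum.
  by apply: eq_bigr => i _; rewrite linearZ /= rowK.
rewrite linear_sum; apply: summx_sub => i _; rewrite linearZ /=.
by apply: scalemx_sub; rewrite -(rowK (fun i => (Eact (nth (Eid R d) raff i) x0 - x0)^T)) row_sub.
Qed.

Lemma Eact1 (x : 'cV[R]_d) : Eact (Eid R d) x = x.
Proof. by rewrite /Eact mul1mx addr0. Qed.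

Lemma span_orbitG g : G g -> span_orbit (Eact g x0 - x0).
Proof.
move=> Gg; have [_ _ affE] := affG.
have : aff_hull [set Eact g x0 | g in G] (Eact g x0).
  exists 1%N, (fun=> Eact g x0), (fun=> 1); split => [_||]; first by exists g.
    by rewrite big_ord1.
  by rewrite big_ord1 scale1r.
rewrite -affE => -[k [p [w [hp w1 ->]]]].
(* The weights sum to one, so an affine combination of orbit points becomes a linear combination of
   differences. *)
have -> : \sum_i w i *: p i - x0 = \sum_i w i *: (p i - x0).
  under [RHS]eq_bigr do rewrite scalerBr.
  by rewrite sumrB -scaler_suml w1 scale1r.
rewrite /span_orbit linear_sum; apply: summx_sub => i _; rewrite linearZ /=.
apply: scalemx_sub; have [h /= hr <-] := hp i.
have ir : (index h raff < size raff)%N by rewrite index_mem.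
set M := (\matrix_i _)%R.
suff -> : (Eact h x0 - x0)^T = row (Ordinal ir) M by apply: row_sub.
by rewrite rowK /= nth_index.
Qed.

Lemma span_orbit_ind (P : 'cV[R]_d -> Prop) :
  P 0 -> (forall x y, P x -> P y -> P (x + y)) -> (forall c x, P x -> P (c *: x)) ->
  (forall h, h \in raff -> P (Eact h x0 - x0)) -> forall z, span_orbit z -> P z.
Proof.
move=> P0 PD PZ Ph z /span_orbitP [w ->].
by apply: big_ind => // i _; apply/PZ/Ph/mem_nth.
Qed.

(** On the spanning differences, [rot(l) (h x0 - x0) = (l h x0 - x0) - (l x0 - x0)]. *)
Lemma span_orbitM l z : G l -> span_orbit z -> span_orbit (l.1 *m z).
Proof.
move=> Gl; have [raffG _ _] := affG.
apply: (span_orbit_ind (P := fun z => span_orbit (l.1 *m z))).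
- by rewrite /span_orbit mulmx0 trmx0 sub0mx.
- by move=> x y hx hy; rewrite /span_orbit mulmxDr linearD /=; apply: addmx_sub.
- by move=> c x hx; rewrite /span_orbit -scalemxAr linearZ /=; apply: scalemx_sub.
- move=> h /raffG Gh; rewrite -Eact_sub -Eact_mul.
  have -> : Eact (Emul l h) x0 - Eact l x0 = (Eact (Emul l h) x0 - x0) - (Eact l x0 - x0).
    by rewrite opprB addrA subrK.
  rewrite /span_orbit linearB /=; apply: addmx_sub; first exact/span_orbitG/GM.
  by rewrite eqmx_opp; apply: span_orbitG.
Qed.

(** A vector orthogonal to all orbit differences is orthogonal to [{0} x R^d2] by
    [bounded_orbit_ptr0]. *)
Lemma span_orbit_ptr w : span_orbit (ptr *m w).
Proof.
rewrite /span_orbit; apply: submx_orthogonal => y hy.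
have hy' g : G g -> dot y (Eact g x0 - x0) = 0.
  move=> Gg; have := span_orbitG Gg; rewrite /span_orbit => /submxP[D hD].
  by rewrite dotC /dot hD -mulmxA hy mulmx0 mxE.
rewrite dot_ptr (@bounded_orbit_ptr0 _ 0) => [|g Gg]; last by rewrite hy' // expr0n.
by rewrite dotE big1 // => i _; rewrite mxE mul0r.
Qed.

(* The translations of [T^m0] span, because the orbit of 0 under G stays within bounded distance of them. *)
Lemma translations_span : exists m (M : 'M[R]_(m, d)),
  (forall i, exists2 t, Tpow T m0 t & (row i M)^T = t.2) /\
  forall w : 'cV[R]_d, ((ptr *m w)^T <= M)%MS.
Proof.
have [m [M [h1 h2]]] := finite_spanning [set t.2 | t in Tpow T m0].
exists m, M; split => [i|w].
  by have [t Tt e] := h1 i; exists t.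
apply: submx_orthogonal => y hy.
have hy' t : Tpow T m0 t -> dot y t.2 = 0.
  move=> Tt; have /submxP[D hD] : (t.2^T <= M)%MS by apply: h2; exists t.
  by rewrite dotC /dot hD -mulmxA hy mulmx0 mxE.
have [_ CmG Ccov _] := Creps m0_gt0 (dvdnn m0).
have [[Go _ _ _] _ TN] := Tnormal m0_gt0 (dvdnn m0).
suff /bounded_orbit_ptr0 : forall g, G g -> dot (ptr *m y) (Eact g x0 - x0) ^+ 2 <=
    \sum_(c <- C m0) dot (ptr *m y) (Eact c x0 - x0) ^+ 2.
  rewrite mulmxA ptrK dot_ptr => ->.
  by rewrite dotE big1 // => i _; rewrite mxE mul0r.
move=> g Gg; have [c cC Tt] := Ccov _ Gg; have Gc := CmG _ cC.
have oc := G_orthogonal Gc.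
(* By normality [g = t c] with [t = c (c^-1 g) c^-1] in [T^m0]. The vector [ptr *m y] does not see
   [t], so the finitely many representatives bound the form on the whole orbit. *)
have := TN _ _ Gc Tt; set t := Emul _ (Einv c) => {}Tt.
have -> : g = Emul t c.
  by rewrite /t -EmulA EmulV // Emulg1 EmulA EmulgV // Emul1.
rewrite Eact_mul {1}/Eact; have [t1 t2] := ptr_T Tt.
have -> : dot (ptr *m y) (t.1 *m Eact c x0 + t.2 - x0) = dot (ptr *m y) (Eact c x0 - x0).
  rewrite !dotBr dotDr -!dot_ptr mulmxA t2 (ptr_trans (TG Tt)) hy' //.
  by rewrite addr0.
rewrite (bigD1_seq c) //=; last by have [] := Creps m0_gt0 (dvdnn m0).
by rewrite lerDl sumr_ge0 // => i _; apply: sqr_ge0.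
Qed.

(** * Propagation of approximate rigidity from the finite range to the group *)

Definition affine_rel k := vdom (fun st g => disp st (Emul g k) -
  k.1^T *m (disp st g + skewp st g *m (Eact k x0 - x0))).

Definition skew_rel k z := vdom (fun st g => skewp st (Emul g k) *m z -
  k.1^T *m (skewp st g *m (k.1 *m z))).

Ltac vec_ring := rewrite ?(mulmxDr, mulmxN, mulNmx); apply/colP => ?; rewrite !mxE; ring.

Lemma GKT g n (y : 'M[R]_(d, n)) : G g -> g.1 *m (g.1^T *m y) = y.
Proof. by move=> /G_orthogonal og; rewrite mulmxA og mul1mx. Qed.

Lemma GTK g n (y : 'M[R]_(d, n)) : G g -> g.1^T *m (g.1 *m y) = y.
Proof. by move=> /G_orthogonal/orthogonal_mxT og; rewrite mulmxA og mul1mx. Qed.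

(** The residual at the identity is [u(g) - a_g]; subtracting [rot(h)^T] times it replaces [a_g] by
    [u(g)]. *)
Lemma affine_rel_r1 h : h \in r1 -> affine_rel h.
Proof.
move=> hr.
have idr : Eid R d \in r1.
  by have := r1_prod gen_id (_ : Eid R d \in raff); rewrite Emul1; apply; case: affG.
apply: vdom_eq (vdomB (vdom_err hr) (vdomM h.1^T (vdom_err idr))) _ => st _ g _ /=.
rewrite Emulg1 Eact1 subrr mulmx0 addr0 trmx1 mul1mx; vec_ring.
Qed.

Lemma orbit_mul (k h : E) : Eact (Emul k h) x0 - x0 =
  k.1 *m (Eact h x0 - x0) + (Eact k x0 - x0).
Proof. by rewrite -Eact_sub -Eact_mul addrA subrK. Qed.

Lemma skew_rel_span k : (forall h, h \in raff -> skew_rel k (Eact h x0 - x0)) ->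
  forall z, span_orbit z -> skew_rel k z.
Proof.
move=> hk; apply: span_orbit_ind => //.
- by apply: vdom_eq (@vdom0 _) _ => st _ g _; rewrite !mulmx0 subr0.
- by move=> x y hx hy; apply: vdom_eq (vdomD hx hy) _ => st _ g _; vec_ring.
- move=> c x hx; apply: vdom_eq (vdomZ c hx) _ => st _ g _.
  by rewrite scalerBr -!scalemxAr.
Qed.

(** [skewp] is tested only along orbit directions, since the residuals in [err] involve no other
    values of it. *)
Definition rel k := affine_rel k /\ forall z, span_orbit z -> skew_rel k z.

(** Since [k], [h] and [kh] all lie in [r1], the value [u(gkh)] can be reached from [g] directly or
    through [gk]; comparing the two isolates [S_{gk}] on [h x0 - x0]. *)
Lemma rel_gen k : k \in rgen -> rel k.
Proof.
move=> kr; have Gk : G k by apply: genG.1.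
have kr1 : k \in r1 by rewrite -(Emulg1 k); apply: r1_prod => //; case: affG.
have ak := affine_rel_r1 kr1; split=> //.
apply: skew_rel_span => // h hr; have Gh : G h by case: affG => + _ _; apply.
have hr1 : h \in r1 by rewrite -(Emul1 h); apply: r1_prod.
have akh := affine_rel_r1 (r1_prod kr hr).
have ah := vdom_shift Gk (affine_rel_r1 hr1).
apply: vdom_eq (vdomB (vdomM h.1 (vdomB akh ah)) ak) _ => st _ g _ /=.
rewrite EmulA trmx_mul -!mulmxA orbit_mul; move: (Eact h _ - _) (Eact k _ - _) => y z.
by rewrite !(mulmxDr, mulmxN) !GKT //; vec_ring.
Qed.

Lemma rel_id : rel (Eid R d).
Proof.
split=> [|z _]; apply: vdom_eq (@vdom0 _) _ => st _ g _ /=.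
  by rewrite Emulg1 Eact1 subrr mulmx0 addr0 trmx1 mul1mx subrr.
by rewrite Emulg1 trmx1 !mul1mx subrr.
Qed.

(** The errors of [kl] at [g] are those of [l] at [gk] plus [rot(l)^T] times errors of [k] at [g];
    the latter are taken along [l x0 - x0] and [rot(l) z], which are again orbit directions. *)
Lemma rel_mul k l : G k -> G l -> rel k -> rel l -> rel (Emul k l).
Proof.
move=> Gk Gl [ak sk] [al sl]; split=> [|z zs].
  have := vdomD (vdom_shift Gk al)
    (vdomM l.1^T (vdomD ak (sk _ (span_orbitG Gl)))).
  move=> /vdom_eq; apply=> st _ g _ /=.
  rewrite EmulA trmx_mul -!mulmxA orbit_mul; move: (Eact l _ - _) (Eact k _ - _) => y z.
  vec_ring.
have := vdomD (vdom_shift Gk (sl _ zs)) (vdomM l.1^T (sk _ (span_orbitM Gl zs))).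
move=> /vdom_eq; apply=> st _ g _ /=.
by rewrite EmulA trmx_mul -!mulmxA; vec_ring.
Qed.

(** The relations of [k] are taken at [g k^-1] and multiplied by [- rot(k)]; in the affine case the
    skew relation of [k^-1] then replaces [S_{g k^-1}] by [S_g]. *)
Lemma rel_inv k : G k -> rel k -> rel (Einv k).
Proof.
move=> Gk [ak sk]; have GVk := GV Gk; have ok := G_orthogonal Gk.
have sV z : span_orbit z -> skew_rel (Einv k) z.
  move=> zs; have := vdom_shift GVk (sk _ (span_orbitM GVk zs)).
  move=> /(vdomM (- k.1)) /vdom_eq; apply=> st _ g _ /=.
  rewrite -EmulA EmulV // Emulg1 trmxK GKT //.
  by rewrite mulmxBr mulNmx mulNmx GKT //; vec_ring.
split=> //.
have zs : span_orbit (Eact k x0 - x0) by apply: span_orbitG.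
have := vdomB (vdomM (- k.1) (vdom_shift GVk ak)) (sV _ zs).
move=> /vdom_eq; apply=> st _ g _ /=.
have -> : Eact (Einv k) x0 - x0 = - (k.1^T *m (Eact k x0 - x0)).
  rewrite -[in X in _ = - (k.1^T *m (_ - X))](Eact1 x0) -(EmulgV ok) Eact_mul Eact_sub.
  by rewrite GTK // opprB.
rewrite -EmulA EmulV // Emulg1 trmxK; move: (Eact k _ - _) => y.
by rewrite !(mulmxDr, mulmxN, mulNmx) !GKT //; vec_ring.
Qed.

(** Induction over a word in the generators: the constants depend on the word, but not on the
    period. *)
Lemma relG k : G k -> rel k.
Proof.
move=> /genG.2 [w [hw ->]].
suff [] : G (foldr (fun p acc => Emul (if p.2 then p.1 else Einv p.1) acc) (Eid R d) w) /\
  rel (foldr (fun p acc => Emul (if p.2 then p.1 else Einv p.1) acc) (Eid R d) w) by [].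
elim: w hw => [_|[g b] w IH hw]; first by split; [exact: G1|exact: rel_id].
have [|Gw rw] := IH; first by move=> p pw; apply: hw; rewrite inE pw orbT.
have gr : g \in rgen by apply: (hw (g, b)); rewrite inE eqxx.
have Gg := genG.1 _ gr; have rg := rel_gen gr.
have GVg := GV Gg; have rVg := rel_inv Gg rg.
by case: b {hw} => /=; split; [exact: GM|exact: rel_mul|exact: GM|exact: rel_mul].
Qed.

(** * Increments along translations and the translational block of the skew matrices *)

(* First-order displacement at [g (0, x02)], in the direction [s.2]: the part of [u] oscillating
   with the rotations in [O(d1)] is cancelled, so that increments along [T^m0] are skew. *)
Definition drift (s : E) st g : R :=
  dot s.2 (disp st g) + dot (x0 - ptr *m x0) (skewp st g *m s.2).

(** With [y = x0 - ptr *m x0], the difference [t x0 - x0] is [rot(t) y - y + b_t]. The affine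
    relation tested with [b_s] produces [b_s . S_g (rot(t) y - y)], which skewness cancels against
    the increment of the second term of [drift]. *)
Lemma drift_increment s t : Tpow T m0 s -> Tpow T m0 t ->
  dom (fun st g => drift s st (Emul g t) - drift s st g - dot s.2 (skewp st g *m t.2)).
Proof.
move=> Ts Tt; have [Gs Gt] := (TG Ts, TG Tt); have [at_ st_] := relG Gt.
have /st_ sts : span_orbit s.2 by rewrite -(ptr_trans Gs); apply: span_orbit_ptr.
apply: dom_eq (domD (at_ s.2) (sts (x0 - ptr *m x0))) _.
move=> st [_ _ _ _ [_ Sk]] g Gg /=.
have [t1 t2] := ptr_T Tt.
have ts : t.1 *m s.2 = s.2 by rewrite -(ptr_trans Gs) mulmxA t1.
have e : Eact t x0 - x0 = t.1 *m (x0 - ptr *m x0) - (x0 - ptr *m x0) + t.2.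
  by rewrite orbit_sub mulmxBr mulmxA t1 opprB addrA subrK.
rewrite /drift e !dotBr [dot _ (t.1^T *m _)]dot_mulmxr [dot _ (t.1^T *m _)]dot_mulmxr !trmxK ts.
move: (x0 - _) => y; have := dot_skew (t.1 *m y) s.2 (Sk g); have := dot_skew y s.2 (Sk g).
by rewrite !(mulmxDr, mulmxN, dotDr, dotNr) => -> ->; ring.
Qed.

Lemma sum_increments_swap N (P Q : E -> R) s t : (0 < N)%N -> (m0 %| N)%N ->
  Tper N P -> Tper N Q -> G s -> G t -> Emul s t = Emul t s ->
  \sum_(g <- C N) (P (Emul g t) - P g) * (Q (Emul g s) - Q g) =
  \sum_(g <- C N) (P (Emul (Emul g t) s) - P (Emul g t)) *
                  (Q (Emul (Emul g s) t) - Q (Emul g s)).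
Proof.
move=> N0 mN Pp Qp Gs Gt st; have cst g : Emul (Emul g s) t = Emul (Emul g t) s.
  by rewrite -!EmulA st.
have pM (f h : E -> R) : Tper N f -> Tper N h -> Tper N (fun g => f g * h g).
  by move=> fp hp g k Gg Tk; rewrite fp // hp.
have sP k : G k -> Tper N (fun g => P (Emul g k)) by move=> ?; apply: Tper_shift.
have sQ k : G k -> Tper N (fun g => Q (Emul g k)) by move=> ?; apply: Tper_shift.
have h1 := sum_shift N0 mN (pM _ _ Pp Qp) (GM Gt Gs).
have h2 := sum_shift N0 mN (pM _ _ (sP _ Gt) Qp) Gs.
have h3 := sum_shift N0 mN (pM _ _ Pp (sQ _ Gs)) Gt.
apply/eqP; rewrite -subr_eq0; apply/eqP.
(* The two sides differ by three pairs of sums, which cancel by translation along [ts], [s] and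
   [t]. *)
transitivity (
  (\sum_(g <- C N) P g * Q g - \sum_(g <- C N) P (Emul g (Emul t s)) * Q (Emul g (Emul t s)))
  + (\sum_(g <- C N) P (Emul (Emul g s) t) * Q (Emul g s) - \sum_(g <- C N) P (Emul g t) * Q g)
  + (\sum_(g <- C N) P (Emul g t) * Q (Emul (Emul g t) s) - \sum_(g <- C N) P g * Q (Emul g s))).
  rewrite -!sumrB -!big_split /=; apply: eq_bigr => g _.
  by rewrite EmulA !cst; ring.
by rewrite h1 h2 h3; ring.
Qed.

(** The inequality is required only after summation over the cosets, which is the form that
    summation by parts provides. *)
Lemma dom_sqr_le q q1 q2 q3 : (forall st, valid st -> Tper (period st) (q st)) ->
  dom q1 -> dom q2 -> dom q3 ->
  (forall st, valid st -> \sum_(g <- C (period st)) q st g ^+ 2 <=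
    \sum_(g <- C (period st)) q1 st g ^+ 2 + \sum_(g <- C (period st)) q2 st g ^+ 2 +
    \sum_(g <- C (period st)) q3 st g ^+ 2) -> dom q.
Proof.
move=> qp [_ [c1 c10 h1]] [_ [c2 c20 h2]] [_ [c3 c30 h3]] h; split=> //.
exists (c1 + c2 + c3) => [|st vst]; first by rewrite !addr_ge0.
apply: le_trans (h _ vst) _; rewrite !mulrDl.
by rewrite lerD ?lerD ?h1 ?h2 ?h3.
Qed.

Lemma dom_drift_increment s t : Tpow T m0 s -> Tpow T m0 t ->
  dom (fun st g => drift s st (Emul g t) - drift s st g).
Proof.
move=> Ts Tt; have [Gs Gt] := (TG Ts, TG Tt).
have dper k st : valid st -> Tper (period st) (drift k st).
  by move=> [_ _ up _ [Sp _]] g h Gg Th; rewrite /drift up // Sp.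
have self k : Tpow T m0 k -> dom (fun st g => drift k st (Emul g k) - drift k st g).
  move=> Tk; apply: dom_eq (drift_increment Tk Tk) _ => st [_ _ _ _ [_ Sk]] g _.
  suff -> : dot k.2 (skewp st g *m k.2) = 0 by rewrite subr0.
  by have := dot_skew k.2 k.2 (Sk g); lra.
have both := domD (drift_increment Ts Tt) (drift_increment Tt Ts).
apply: dom_sqr_le both (dom_shift Gt (self _ Ts)) (dom_shift Gs (self _ Tt)) _.
  move=> st vst g k Gg Tk; have [N0 mN _ _ _] := vst.
  by rewrite (Tper_shift N0 mN (dper s _ vst) Gt) // (dper s _ vst g k).
move=> st vst; have [N0 mN _ _ [_ Sk]] := vst.
have := sum_increments_swap N0 mN (dper s _ vst) (dper t _ vst) Gs Gt (Tcomm Ts Tt).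
set A := \sum_(g <- _) _ * _ => AE.
rewrite -subr_ge0.
(* Skewness cancels the two terms with [skewp], leaving [(D_t p_s + D_s p_t)^2], whose cross terms
   sum to [2 * A]. *)
have -> : \sum_(g <- C (period st)) (drift s st (Emul g t) - drift s st g
      - dot s.2 (skewp st g *m t.2) + (drift t st (Emul g s) - drift t st g
      - dot t.2 (skewp st g *m s.2))) ^+ 2 =
    \sum_(g <- C (period st)) (drift s st (Emul g t) - drift s st g) ^+ 2 +
    \sum_(g <- C (period st)) (drift t st (Emul g s) - drift t st g) ^+ 2 + 2 * A.
  rewrite /A mulr_sumr -!big_split /=; apply: eq_bigr => g _.
  by rewrite (dot_skew s.2 t.2 (Sk g)); ring.
set X := \sum_(g <- _) (drift s st (Emul g t) - _) ^+ 2.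
have Y0 : 0 <= \sum_(g <- C (period st)) (drift t st (Emul g s) - drift t st g) ^+ 2.
  by apply: sumr_ge0 => g _; apply: sqr_ge0.
set Y := \sum_(g <- _) _ in Y0 *.
set Z := \sum_(g <- _) _ ^+ 2; set W := \sum_(g <- _) _ ^+ 2.
(* By [AE], [A] is a sum of products [a b] with the squares of [a] and of [b] summing to [Z] and
   [W], so [2 a b >= - a^2 - b^2] suffices. *)
have : 0 <= Z + W + 2 * A; last by lra.
rewrite AE /Z /W mulr_sumr -!big_split; apply: sumr_ge0 => g _ /=.
move: (_ - _) (_ - _) => a b; have := sqr_ge0 (a + b); rewrite !expr2; lra.
Qed.

(** On translation parts, subtracting [drift_increment] from [dom_drift_increment] leaves the form
    [b_s . S_g b_t] itself; bilinearity extends the bound to their span. *)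
Lemma dom_skew_ptr x y : dom (fun st g => dot (ptr *m x) (skewp st g *m (ptr *m y))).
Proof.
have [m [M [hM spanM]]] := translations_span.
have /submxP [Dx hx] := spanM x; have /submxP [Dy hy] := spanM y.
have tr (D : 'rV_m) : (D *m M)^T = \sum_i D 0 i *: (row i M)^T.
  by rewrite mulmx_sum_row linear_sum; apply: eq_bigr => i _; rewrite linearZ.
have xE : ptr *m x = \sum_i Dx 0 i *: (row i M)^T by rewrite -tr -hx trmxK.
have yE : ptr *m y = \sum_i Dy 0 i *: (row i M)^T by rewrite -tr -hy trmxK.
have dij i j : dom (fun st g => dot (row i M)^T (skewp st g *m (row j M)^T)).
  have [s Ts ->] := hM i; have [t Tt ->] := hM j.
  apply: dom_eq (domB (dom_drift_increment Ts Tt) (drift_increment Ts Tt)) _.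
  by move=> st _ g _; ring.
apply: dom_eq (dom_sum (index_enum 'I_m) (fun i => domZ (Dx 0 i)
  (dom_sum (index_enum 'I_m) (fun j => domZ (Dy 0 j) (dij i j))))) _.
move=> st _ g _; rewrite xE yE.
have dot_sum (I : finType) (F : I -> 'cV[R]_d) z : dot z (\sum_i F i) = \sum_i dot z (F i).
  by rewrite /dot mulmx_sumr summxE.
rewrite dotC dot_sum; apply: eq_bigr => i _; rewrite dotZr; congr (_ * _).
rewrite dotC mulmx_sumr dot_sum; apply: eq_bigr => j _.
by rewrite -scalemxAr dotZr.
Qed.

Lemma vdom_skew_ptr y : vdom (fun st g => ptr *m (skewp st g *m (ptr *m y))).
Proof. by move=> x; apply: dom_eq (dom_skew_ptr x y) _ => st _ g _; rewrite dot_ptr. Qed.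

(** * The Korn-type inequality and the kernel *)

Lemma grad_estimate (r2 : seq E) : (forall h, h \in r2 -> G h) ->
  exists2 c : R, 0 <= c & forall st, valid st ->
    \sum_(g <- C (period st)) \sum_(h <- r2) sqnorm_mx (disp st (Emul g h) -
      h.1^T *m (disp st g + (skewp st g - ptr *m skewp st g *m ptr) *m (Eact h x0 - x0)))
    <= c * \sum_(g <- C (period st)) err st g.
Proof.
elim: r2 => [_|h r2 IH r2G].
  by exists 0 => // st _; rewrite big1 ?mul0r // => g _; rewrite big_nil.
have [|c c0 hc] := IH; first by move=> k kr; apply: r2G; rewrite inE kr orbT.
have Gh : G h by apply: r2G; rewrite inE eqxx.
have [ah _] := relG Gh.
(* Removing the lower right block of [S_g] adds the term [ptr S_g ptr (h x0 - x0)], which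
   [vdom_skew_ptr] dominates. *)
have [c' c'0 hc'] := vdom_sqnorm
  (vdomD ah (vdomM h.1^T (vdom_skew_ptr (Eact h x0 - x0)))).
exists (c' + c) => [|st vst]; first by rewrite addr_ge0.
under eq_bigr do rewrite big_cons.
rewrite big_split mulrDl; apply: lerD; last exact: hc.
apply: le_trans (hc' _ vst); rewrite le_eqVlt; apply/orP; left; apply/eqP.
apply: eq_bigr => g _; congr (sqnorm_mx _).
by rewrite mulmxBl !mulmxA -!(mulmxA ptr) -!mulmxA; vec_ring.
Qed.

(** Without error the affine relation at the identity determines [u] from [u(id)] and [S = S_id].
    Periodicity makes [u] bounded, hence [S (g x0 - x0)] is bounded and [bounded_orbit_ptr0] forces
    [S *m ptr = 0]. *)
Lemma kernel_form st : valid st -> \sum_(g <- C (period st)) err st g = 0 ->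
  exists (a : 'cV[R]_d) (S : 'M[R]_d1), skew_mx S /\
    forall g, G g -> g.1 *m disp st g = a + block_mx S 0 0 (0 : 'M[R]_d2) *m (Eact g x0 - x0).
Proof.
move=> vst e0; set u := disp st; set S := skewp st (Eid R d).
have [N0 mN up _ [_ /(_ (Eid R d)) Sk]] := vst; rewrite -/S in Sk.
have uE g : G g -> g.1 *m u g = u (Eid R d) + S *m (Eact g x0 - x0).
  move=> Gg; have [ag _] := relG Gg.
  have := vdom_eq0 ag vst e0 G1; rewrite Emul1 => /eqP; rewrite subr_eq0 => /eqP.
  by rewrite -/u => ->; rewrite GKT.
have ubound g : G g -> sqnorm_mx (u g) <= \sum_(c <- C (period st)) sqnorm_mx (u c).
  move=> Gg; have [Cu CmG cov _] := Creps N0 mN; have [c cC Tc] := cov _ Gg.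
  have -> : u g = u c.
    rewrite /u -(up _ _ (CmG _ cC) Tc) EmulA EmulgV ?Emul1 //.
    exact/G_orthogonal/CmG.
  by rewrite (bigD1_seq c) //= lerDl sumr_ge0 // => i _; apply: sqnorm_ge0.
have Sptr : S *m ptr = 0.
  apply: trmx_inj; rewrite trmx_mul ptr_sym trmx0; apply/matrixP => i j.
  suff /colP/(_ i) : ptr *m (S^T *m delta_mx j 0) = 0 :> 'cV_d.
    by rewrite mulmxA -colE [LHS]mxE => ->; rewrite !mxE.
  set e : 'cV_d := delta_mx j 0.
  (* The factor 4 comes from [(a - b)^2 <= 2 a^2 + 2 b^2] with both squares below the same bound. *)
  apply: (@bounded_orbit_ptr0 _ (4 * (sqnorm_mx e *
    \sum_(c <- C (period st)) sqnorm_mx (u c)))) => g Gg.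
  rewrite -dot_mulmxr (_ : S *m _ = g.1 *m u g - u (Eid R d)); last first.
    by rewrite uE // [RHS]addrC addKr.
  have bd k z : G k -> sqnorm_mx z = sqnorm_mx (u k) -> dot e z ^+ 2 <=
      sqnorm_mx e * \sum_(c <- C (period st)) sqnorm_mx (u c).
    move=> Gk zu; apply: le_trans (dot_CauchySchwarz _ _) _; rewrite zu.
    by apply: ler_wpM2l (ubound _ Gk); apply: sqnorm_ge0.
  have h1 := bd g (g.1 *m u g) Gg (sqnorm_orthogonal _ (orthogonal_mxT (G_orthogonal Gg))).
  have h2 := bd _ (u (Eid R d)) G1 erefl.
  rewrite dotBr; move: (dot e _) (dot e _) h1 h2 => a b.
  by have := sqr_ge0 (a + b); rewrite !expr2; lra.
exists (u (Eid R d)), (ulsubmx S).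
have [ur0 dr0] : ursubmx S = 0 /\ drsubmx S = 0.
  move: Sptr; rewrite -{1}(submxK S) /ptr mulmx_block !(mulmx0, mulmx1, add0r).
  by rewrite -(block_mx0 _ d1 d2 d1 d2) => /eq_block_mx [_ -> _ ->].
move: Sk; rewrite /skew_mx -{1 2}(submxK S) tr_block_mx opp_block_mx.
move=> /eq_block_mx [ul _ dl _]; split=> // g Gg.
rewrite uE // -{1}(submxK S) ur0 dr0.
suff -> : dlsubmx S = 0 by [].
by rewrite -[LHS]opprK -dl ur0 trmx0 oppr0.
Qed.

Lemma skew0_sub (S : 'M[R]_d) : skew_mx S -> skew0 (S - ptr *m S *m ptr).
Proof.
rewrite /skew_mx -(submxK S) => Sk.
move: (Sk); rewrite tr_block_mx opp_block_mx => /eq_block_mx [ul ur dl dr].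
exists (ulsubmx S), (ursubmx S); split => //.
rewrite /ptr !mulmx_block !(mul0mx, mulmx0, mulmx1, mul1mx, addr0, add0r).
by rewrite opp_block_mx add_block_mx !oppr0 !addr0 subrr dl opprK.
Qed.

(** Minimizers are chosen as a function of the local displacement rather than of [g], so that they
    inherit its periodicity. *)
Lemma state_of_displacement N (u : V) : (0 < N)%N -> (m0 %| N)%N -> Tper N u ->
  exists st, [/\ valid st, period st = N, disp st = u &
    forall g, err st g <= distR r1 (fun h => u (Emul g h)) (U_iso x0 r1) ^+ 2].
Proof.
move=> N0 mN up.
have ro h : h \in r1 -> orthogonal_mx h.1 by move/r1G/G_orthogonal.
have /choice [p hp] : forall v : V, exists p : 'cV[R]_d * 'M[R]_d, skew_mx p.2 /\
    distR r1 v (U_iso x0 r1) ^+ 2 = \sum_(h <- undup r1)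
      sqnorm_mx (v h - h.1^T *m (p.1 + p.2 *m (Eact h x0 - x0))).
  by move=> v; have [a [S [Sk e]]] := U_iso_minimizer x0 ro v; exists (a, S).
(* The default 0 off [r1] makes [v (g t)] and [v g] equal as functions; periodicity of [u] says
   nothing about [h] outside [G]. *)
pose v g h : 'cV[R]_d := if h \in r1 then u (Emul g h) else 0.
have vp : Tper N v.
  move=> g t Gg Tt; apply/funext => h; rewrite /v; case: ifP => // /r1G Gh.
  by rewrite (Tper_shift N0 mN up Gh).
exists (State N u (fun g => (p (v g)).1) (fun g => (p (v g)).2)); split => // [|g].
  by split => // [g t Gg Tt /=|]; [rewrite vp|split => [g t Gg Tt /=|g /=]; [rewrite vp|case: (hp (v g))]].
have iso0 : U_iso x0 r1 !=set0.
  exists (fun=> 0); apply/(U_isoP x0 ro); exists 0, 0; split.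
    by rewrite /skew_mx trmx0 oppr0.
  by move=> h _; rewrite mul0mx addr0 mulmx0.
apply: (@le_trans _ _ (distR r1 (v g) (U_iso x0 r1) ^+ 2)).
  rewrite (hp (v g)).2 le_eqVlt; apply/orP; left; apply/eqP.
  by apply: eq_big_seq => h; rewrite mem_undup /v => -> /=.
rewrite ler_sqr ?nnegrE ?distR_ge0 //; apply: distR_mono => // w Uw.
by exists w => // h hr; rewrite /v hr.
Qed.

Lemma avg_sem_le N (F F' : E -> R) (c : R) : 0 <= c ->
  \sum_(g <- C N) F g ^+ 2 <= c * \sum_(g <- C N) F' g ^+ 2 ->
  avg_sem C N F <= Num.sqrt c * avg_sem C N F'.
Proof.
move=> c0 h; rewrite /avg_sem -sqrtrM // ler_wsqrtr // mulrCA.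
by rewrite ler_wpM2l // invr_ge0.
Qed.

(** Compares the largest seminorm on an arbitrary finite range with the smallest one on [r1]: the
    minimizing [S_g], stripped of its lower right block, is a competitor for the gradient. *)
Lemma korn (r2 : seq E) : (forall h, h \in r2 -> G h) ->
  exists2 c : R, 0 < c & forall N, (0 < N)%N -> (m0 %| N)%N -> forall u, periodic G T N u ->
    semR0 x0 C r2 N u <= c * normR x0 C r1 N u.
Proof.
move=> r2G; have [|c c0 hc] := @grad_estimate (undup r2).
  by move=> h; rewrite mem_undup; apply: r2G.
(* Adding 1 keeps the constant positive when [c = 0]. *)
exists (Num.sqrt (c + 1)) => [|N N0 mN u up]; first by rewrite sqrtr_gt0 ltr_pwDr.
have [st [vst stN stu ste]] := state_of_displacement N0 mN up.
apply: avg_sem_le; first by rewrite addr_ge0.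
have := hc _ vst; rewrite stN stu => {}hc.
apply: (@le_trans _ _ (c * \sum_(g <- C N) err st g)); last first.
  apply: ler_pM => //; first by rewrite -stN sum_err_ge0.
    by rewrite lerDl.
  by apply: ler_sum => g _; apply: ste.
apply: le_trans hc; apply: ler_sum => g _; have [_ _ _ _ [_ Sk]] := vst.
set S0 := skewp st g - _.
have US : U_rot0 x0 r2 (fun h => h.1^T *m (S0 *m (Eact h x0 - x0))).
  exists S0; split; first exact: skew0_sub.
  by move=> h /r2G Gh; rewrite GKT.
apply: le_trans (sqr_distR_le r2 (grad r2 u g) US) _.
rewrite le_eqVlt; apply/orP; left; apply/eqP.
by apply: eq_bigr => h _; rewrite /grad [h.1^T *m (u g + _)]mulmxDr opprD addrA.
Qed.

Lemma normR_eq0 N u : (0 < N)%N -> (m0 %| N)%N -> periodic G T N u ->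
  normR x0 C r1 N u = 0 <-> U_iso00 G x0 u.
Proof.
move=> N0 mN up; have [_ CmG cov _] := Creps N0 mN.
have ro h : h \in r1 -> orthogonal_mx h.1 by move/r1G/G_orthogonal.
split=> [|[a [S [Sk uE]]]].
  have [st [vst stN stu ste]] := state_of_displacement N0 mN up.
  have : 0 < ((size (C N))%:R^-1 : R).
    have [c cC _] := cov _ G1.
    by rewrite invr_gt0 ltr0n; case: (C N) cC.
  move=> n0 /eqP; rewrite sqrtr_eq0 pmulr_rle0 // => le0.
  have [|a [S [Sk uE]]] := kernel_form vst.
    apply/eqP; rewrite eq_le sum_err_ge0 andbT; apply: le_trans le0.
    by rewrite stN; apply: ler_sum => g _; apply: ste.
  by exists a, S; rewrite -stu.
rewrite /normR /avg_sem big_seq big1 ?mulr0 ?sqrtr0 // => g /CmG Gg.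
apply/eqP; rewrite sqrf_eq0 eq_le.
set Q := block_mx _ _ _ _ in uE.
have Qs : skew_mx Q by rewrite /skew_mx tr_block_mx Sk !trmx0 opp_block_mx !oppr0.
have Uu : U_iso x0 r1 (fun h => u (Emul g h)).
  (* Seen from [g], the rigid motion has translation [u g] and the skew matrix conjugated by
     [rot(g)]. *)
  apply/(U_isoP x0 ro); exists (u g), (g.1^T *m Q *m g.1); split.
    by rewrite /skew_mx !trmx_mul trmxK Qs mulNmx mulmxN mulmxA.
  move=> h /r1G Gh; have Ggh := GM Gg Gh.
  rewrite -[LHS](GTK _ Ggh) uE // -[u g](GTK _ Gg) uE // trmx_mul -!mulmxA orbit_mul.
  by move: (Eact g _ - _) (Eact h _ - _) => y z; vec_ring.
rewrite distR_ge0 ?andbT; last by exists (fun h => u (Emul g h)).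
apply: le_trans (distR_le _ _ Uu) _; rewrite /fnorm big1 ?sqrtr0 // => h _.
by rewrite subrr sqnorm_dot dotE big1 // => i _; rewrite mxE mul0r.
Qed.

End Domination.

(** * Elementary comparisons among the eight seminorms *)

Section EightSeminorms.
Context {R : realType} {d1 d2 : nat}.
Local Notation d := (d1 + d2)%N.
Local Notation E := (Eu R d).
Variables (C : nat -> seq E) (x0 : 'cV[R]_d).

Lemma skew0_skew (S : 'M[R]_d) : skew0 S -> skew_mx S.
Proof.
move=> [S1 [S2 [Sk ->]]]; rewrite /skew_mx tr_block_mx Sk opp_block_mx.
by rewrite linearN /= trmxK trmx0 oppr0 opprK.
Qed.

Lemma U_rot0_neq0 (r : seq E) : U_rot0 x0 r !=set0.
Proof.
exists (fun=> 0), 0; split=> [|g _]; last by rewrite mulmx0 mul0mx.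
exists 0, 0; split; first by rewrite /skew_mx trmx0 oppr0.
by rewrite trmx0 oppr0 block_mx0.
Qed.

Lemma sub_U_rot0 (r : seq E) : U_rot0 x0 r `<=` U_rot x0 r.
Proof. by move=> w [S [/skew0_skew Sk e]]; exists S. Qed.

Lemma Usum_neq0 (r : seq E) (U : set (E -> 'cV[R]_d)) :
  U !=set0 -> Usum r (U_trans r) U !=set0.
Proof.
move=> [w Uw]; exists w, (fun=> 0), w; split=> // [|h _]; last by rewrite add0r.
by exists 0 => g _; rewrite mulmx0.
Qed.

Lemma avg_sem_mono N (F F' : E -> R) :
  (forall g, 0 <= F g) -> (forall g, F g <= F' g) -> avg_sem C N F <= avg_sem C N F'.
Proof.
move=> F0 FF'; rewrite ler_wsqrtr // ler_wpM2l ?invr_ge0 //.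
by apply: ler_sum => g _; rewrite ler_sqr ?nnegrE // (le_trans (F0 g)).
Qed.

Section OneRange.
Variable r : seq E.
Hypothesis ro : forall h, h \in r -> orthogonal_mx h.1.

(** The gradient differs from [u(g .)] by [h |-> rot(h)^T u(g)], which lies in [U_trans]. *)
Lemma distR_iso_le_rot u (g : E) (U : set (E -> 'cV[R]_d)) : U !=set0 ->
  distR r (fun h => u (Emul g h)) (Usum r (U_trans r) U) <= distR r (grad r u g) U.
Proof.
move=> U0; apply: distR_mono => // w Uw.
exists (fun h => h.1^T *m u g + w h).
  exists (fun h => h.1^T *m u g), w; split=> //.
  by exists (u g) => h hr; rewrite mulmxA ro // mul1mx.
by move=> h hr; rewrite /grad opprD addrA.
Qed.

Lemma normR_le_normR0 N u : normR x0 C r N u <= normR0 x0 C r N u.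
Proof.
have i0 := Usum_neq0 r (U_rot0_neq0 r).
apply: avg_sem_mono => g.
  apply: distR_ge0; apply: Usum_neq0; have [w hw] := U_rot0_neq0 r.
  by exists w; apply: sub_U_rot0.
apply: distR_mono => // w [w1 [w2 [h1 h2 h3]]]; exists w => //.
by exists w1, w2; split => //; apply: sub_U_rot0.
Qed.

Lemma normR_le_semR N u : normR x0 C r N u <= semR x0 C r N u.
Proof.
have r0 : U_rot x0 r !=set0.
  by have [w hw] := U_rot0_neq0 r; exists w; apply: sub_U_rot0.
apply: avg_sem_mono => g; last exact: distR_iso_le_rot.
by apply: distR_ge0; apply: Usum_neq0.
Qed.

Lemma normR0_le_semR0 N u : normR0 x0 C r N u <= semR0 x0 C r N u.
Proof.
have r0 := U_rot0_neq0 r.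
apply: avg_sem_mono => g; last exact: distR_iso_le_rot.
by apply: distR_ge0; apply: Usum_neq0.
Qed.

Lemma semR_le_semR0 N u : semR x0 C r N u <= semR0 x0 C r N u.
Proof.
have r0 := U_rot0_neq0 r.
apply: avg_sem_mono => g.
  by apply: distR_ge0; have [w hw] := r0; exists w; apply: sub_U_rot0.
by apply: distR_mono => // w hw; exists w => //; apply: sub_U_rot0.
Qed.

End OneRange.

(** Distances grow when the space shrinks, so on each range [semR0] is the largest of the four and
    [normR] the smallest. *)
Lemma eight_seminorms_le_semR0 (r1 r2 : seq E) (i : 'I_8) :
  (forall h, h \in r1 -> orthogonal_mx h.1) -> (forall h, h \in r2 -> orthogonal_mx h.1) ->
  exists2 r, r \in [:: r1; r2] &
    forall N u, eight_seminorms x0 C r1 r2 i N u <= semR0 x0 C r N u.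
Proof.
(* The list alternates between the two ranges, so the parity of [i] selects the range. *)
move=> o1 o2; exists (if odd i then r2 else r1); first by case: odd; rewrite !inE eqxx ?orbT.
case: i => [[|[|[|[|[|[|[|[|//]]]]]]]] ?] N u //=.
- exact: le_trans (normR_le_normR0 _ _ _) (normR0_le_semR0 o1 _ _).
- exact: le_trans (normR_le_normR0 _ _ _) (normR0_le_semR0 o2 _ _).
- exact: normR0_le_semR0.
- exact: normR0_le_semR0.
- exact: semR_le_semR0.
- exact: semR_le_semR0.
Qed.

Lemma normR_le_eight_seminorms (r1 r2 : seq E) (i : 'I_8) :
  (forall h, h \in r1 -> orthogonal_mx h.1) -> (forall h, h \in r2 -> orthogonal_mx h.1) ->
  exists2 r, r \in [:: r1; r2] &
    forall N u, normR x0 C r N u <= eight_seminorms x0 C r1 r2 i N u.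
Proof.
move=> o1 o2; exists (if odd i then r2 else r1); first by case: odd; rewrite !inE eqxx ?orbT.
case: i => [[|[|[|[|[|[|[|[|//]]]]]]]] ?] N u //=.
- exact: normR_le_normR0.
- exact: normR_le_normR0.
- exact: normR_le_semR.
- exact: normR_le_semR.
- exact: le_trans (normR_le_semR o1 _ _) (semR_le_semR0 _ _ _).
- exact: le_trans (normR_le_semR o2 _ _) (semR_le_semR0 _ _ _).
Qed.

Lemma eight_seminorms_ge0 (r1 r2 : seq E) (i : 'I_8) N u :
  0 <= eight_seminorms x0 C r1 r2 i N u.
Proof. by case: i => [[|[|[|[|[|[|[|[|//]]]]]]]] ?]; apply: sqrtr_ge0. Qed.

End EightSeminorms.

(** * From the standing setting to the equivalence and the kernel *)

Lemma proj_Epow (R : realType) (d1 d2 : nat) (t : Eu R (d1 + d2)) n :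
  (exists A, t.1 = block_mx A 0 0 1%:M) -> drsubmx (Epow t n).1 = 1%:M.
Proof.
(* The whole block shape is carried through the induction, since the lower right block of a product
   depends on other blocks as well. *)
move=> [A tE]; suff [B ->] : exists B, (Epow t n).1 = block_mx B 0 0 1%:M by rewrite block_mxKdr.
elim: n => [|n [B IH]]; first by exists 1%:M; rewrite /= -scalar_mx_block.
exists (A *m B); rewrite /Epow iterS -/(Epow t n) /= tE IH mulmx_block.
by rewrite !(mul0mx, mulmx0, mulmx1, addr0, add0r).
Qed.

Unset Implicit Arguments.

Theorem theorem3p31 (R : realType) (d1 d2 : nat) (S : set (Eu R d2))
    (G T : set (Eu R (d1 + d2))) (m0 : nat) (C : nat -> seq (Eu R (d1 + d2)))
    (x0 : 'cV[R]_(d1 + d2)) (daff : nat) :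
  standing_setting S G T m0 C x0 daff ->
  forall r1 r2 : seq (Eu R (d1 + d2)),
  Property2 G x0 r1 -> Property2 G x0 r2 ->
  (forall i j : 'I_8, exists2 c : R, 0 < c &
     forall N : nat, (0 < N)%N -> (m0 %| N)%N ->
     forall u : Eu R (d1 + d2) -> 'cV[R]_(d1 + d2), periodic G T N u ->
       eight_seminorms x0 C r1 r2 i N u <= c * eight_seminorms x0 C r1 r2 j N u) /\
  (forall i : 'I_8, forall N : nat, (0 < N)%N -> (m0 %| N)%N ->
     forall u : Eu R (d1 + d2) -> 'cV[R]_(d1 + d2), periodic G T N u ->
       (eight_seminorms x0 C r1 r2 i N u = 0 <-> U_iso00 G x0 u)).
Proof.
move=> [[_ _ [rho hrho]] [GG _] [Gform Gonto [TsubG _ projT]]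
  [[m0_gt0 Tnorm] Tiso Creps] _] r1 r2 P1 P2.
have Tnormal N : (0 < N)%N -> (m0 %| N)%N -> normal_subgroup (Tpow T N) G.
  by move=> N0 /(Tnorm _ N0).
have Gblock g : G g -> exists A (s : Eu R d2), orthogonal_mx A /\ g = dsum A s.
  by move=> /Gform [A [s [oA _ ->]]]; exists A, s.
have cocompact : exists rho, forall x : 'cV[R]_d2,
    exists2 g, G g & sqnorm_mx (x - dsubmx g.2) <= rho.
  exists rho => x; have [s Ss hs] := hrho x; have [g Gg gs] := Gonto _ Ss.
  exists g => //; suff -> : dsubmx g.2 = Eact s 0 by [].
  by rewrite -gs /Eact mulmx0 add0r.
(* [T^m0] is the image of the abelian group [Z^d2]. *)
have Tcomm s t : Tpow T m0 s -> Tpow T m0 t -> Emul s t = Emul t s.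
  have [phi [phiD _ <-]] := Tiso _ m0_gt0 (dvdnn m0).
  by move=> [a _ <-] [b _ <-]; rewrite -!phiD addrC.
have Ttrans t : Tpow T m0 t -> drsubmx t.1 = 1%:M.
  move=> [t' Tt' <-]; apply: proj_Epow.
  have [A [s [_ ts]]] := Gblock _ (TsubG _ Tt').
  have : translation_subgroup S (proj t') by rewrite -projT; exists t'.
  by move=> [_ /=]; rewrite ts /= block_mxKdr => ->; exists A.
have Go g : G g -> orthogonal_mx g.1 by case: GG => h _ _ _; apply: h.
have rG r : r \in [:: r1; r2] -> forall h, h \in r -> G h.
  by rewrite !inE => /orP [] /eqP ->; [case: P1|case: P2].
have o1 h : h \in r1 -> orthogonal_mx h.1 by case: P1 => r1G _ /r1G /Go.
have o2 h : h \in r2 -> orthogonal_mx h.1 by case: P2 => r2G _ /r2G /Go.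
have r1in : r1 \in [:: r1; r2] by rewrite inE eqxx.
have kornR r r' : r \in [:: r1; r2] -> r' \in [:: r1; r2] -> exists2 c : R, 0 < c &
    forall N, (0 < N)%N -> (m0 %| N)%N -> forall u, periodic G T N u ->
      semR0 x0 C r N u <= c * normR x0 C r' N u.
  move=> rr rr'; have r'G := rG _ rr'.
  have [_ [rgen [raff [gen_id genG affG prodG]]]] : Property2 G x0 r'.
    by move: rr'; rewrite !inE => /orP [] /eqP ->.
  exact: (korn GG Tnormal Creps r'G Gblock cocompact m0_gt0 Tcomm Ttrans
    gen_id genG affG prodG (rG _ rr)).
have equiv (i j : 'I_8) : exists2 c : R, 0 < c &
     forall N : nat, (0 < N)%N -> (m0 %| N)%N ->
     forall u : Eu R (d1 + d2) -> 'cV[R]_(d1 + d2), periodic G T N u ->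
       eight_seminorms x0 C r1 r2 i N u <= c * eight_seminorms x0 C r1 r2 j N u.
  (* The chain runs from seminorm [i] to [semR0] on [r], then by [kornR] to [normR] on [r'], then to
     seminorm [j]. *)
  have [r rr hr] := eight_seminorms_le_semR0 C x0 i o1 o2.
  have [r' rr' hr'] := normR_le_eight_seminorms C x0 j o1 o2.
  have [c c0 hc] := kornR _ _ rr rr'; exists c => // N N0 mN u up.
  apply: le_trans (hr N u) (le_trans (hc _ N0 mN _ up) _).
  by rewrite ler_pM2l.
split=> // i N N0 mN u up.
have [_ [rgen [raff [gen_id genG affG prodG]]]] := P1.
have := normR_eq0 GG Tnormal Creps (rG _ r1in) Gblock cocompact
    gen_id genG affG prodG N0 mN up.
(* Index 0 is [normR] on [r1], whose kernel is known; the equivalence transfers vanishing in both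
   directions. *)
move=> <-; pose i0 : 'I_8 := ord0; split=> e0; apply/eqP; rewrite eq_le.
  have [c _ /(_ _ N0 mN _ up)] := equiv i0 i; rewrite e0 mulr0 => ->.
  exact: (eight_seminorms_ge0 C x0 r1 r2 i0).
have [c _ /(_ _ N0 mN _ up)] := equiv i i0; rewrite {2}/eight_seminorms /= e0 mulr0 => ->.
exact: eight_seminorms_ge0.
Qed.
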